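(* The subspace $\mathcal M^+(z,\Pi)=\bigoplus_{n\ge0}\bigoplus_{\lambda\in\mathbb Z_{\ge0}^N,|\lambda|=n}\mathcal M^{+(n)}_\lambda(z^{(n)},\Pi_\lambda)$ of the graded vector space $\mathcal M(z,\Pi)=\bigoplus_{n\ge0}\bigoplus_{|\lambda|=n}\mathcal M^{(n)}_\lambda(z^{(n)},\Pi_\lambda)$ is closed under the product $\star$.
   Context: **Theta function.** $0<|q|<1$ (branch of $\log q$ fixed), $r$ a generic positive real, $p=q^{2r}$, $\tau$ defined by $2r\log q=-2\pi i/\tau$; $[u]=q^{u^2/r-u}\Theta_p(q^{2u})$, $\Theta_p(z)=(z;p)_\infty(p/z;p)_\infty(p;p)_\infty$, $(x;p)_\infty=\prod_{n\ge0}(1-xp^n)$. **Combinatorics and variables.** $\mathcal I_\lambda$ is the set of partitions $I=(I_1,\dots,I_N)$ of $\{1,\dots,n\}$ ($n=|\lambda|$) with $|I_l|=\lambda_l$; $I=I_{\mu_1\cdots\mu_n}$ means $I_l=\{i:\mu_i=l\}$. $\lambda^{(l)}=\lambda_1+\cdots+\lambda_l$, $I^{(l)}=I_1\cup\cdots\cup I_l=\{i^{(l)}_1<\cdots<i^{(l)}_{\lambda^{(l)}}\}$. $t=(t^{(l)}_a)_{1\le l\le N-1,1\le a\le\lambda^{(l)}}$, $t^{(l)}_a=q^{2v^{(l)}_a}$, $z_k=q^{2u_k}$, $v^{(N)}_k=u_k$. Dynamical parameters $(P+h)_{j,k}$, $(P+h)_{j,k}+(P+h)_{k,l}=(P+h)_{j,l}$,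 $\Pi_{j,k}=q^{2(P+h)_{j,k}}$. $\langle\bar\epsilon_\mu,h_{j,k}\rangle=\delta_{\mu,j}-\delta_{\mu,k}$; $\Pi q^{-2\sum_j\langle\bar\epsilon_{\mu_j},h\rangle}$ means $(P+h)_{i,k}\mapsto(P+h)_{i,k}-\sum_j\langle\bar\epsilon_{\mu_j},h_{i,k}\rangle$. Elements are regarded as functions of $t,z$ and of the dynamical parameters. $C_{\mu_s,l+1}(s)=\sum_{j=s+1}^n\langle\bar\epsilon_{\mu_j},h_{\mu_s,l+1}\rangle$. $\Pi_\lambda$ is the collection of the $\Pi_{j,k}$ relevant for $\mathcal I_\lambda$. **The space $\mathcal M^{(n)}_\lambda(z^{(n)},\Pi_\lambda)$.** Meromorphic functions $F(t;z,\Pi)$ of $t$ which are (1) symmetric in $t^{(l)}_1,\dots,t^{(l)}_{\lambda^{(l)}}$ for each $l$, and (2) invariant under $v^{(l)}_a\mapsto v^{(l)}_a+r$ and multiplied by $\exp\{\frac{2\pi i}r((P+h)_{l,l+1}-\lambda_l)\}$ under $v^{(l)}_a\mapsto v^{(l)}_a+r\tau$, for all $l,a$. $\mathcal M^{(0)}_{(0,\dots,0)}=\mathbb C1$. **The product $\star$.** For $F\in\mathcal M^{(m)}_\lambda(z^{(m)},\Pi_\lambda)$ and $G\in\mathcal M^{(n)}_{\lambda'}(z'^{(n)},\Pi_{\lambda'})$, $$(F\star G)(t\cup t';z_1,\dots,z_{m+n},\Pi)=\frac1{\prod_{l=1}^{N-1}\lambda^{(l)}!\lambda'^{(l)}!}\mathrm{Sym}^{(1)}\cdots\mathrm{Sym}^{(N-1)}\Big[F(t,z,\Pi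 q^{-2\sum_{j=1}^n\langle\bar\epsilon_{\mu'_j},h\rangle})\,G(t',z',\Pi)\,\Xi(t,t',z,z')\Big],$$ $$\Xi=\prod_{l=1}^{N-1}\prod_{a=1}^{\lambda^{(l)}}\Big(\prod_{b=1}^{\lambda'^{(l+1)}}\frac{[v'^{(l+1)}_b-v^{(l)}_a]}{[v'^{(l+1)}_b-v^{(l)}_a+1]}\prod_{c=1}^{\lambda'^{(l)}}\frac{[v'^{(l)}_c-v^{(l)}_a+1]}{[v'^{(l)}_c-v^{(l)}_a]}\Big),$$ where $\sum_j\bar\epsilon_{\mu'_j}=\sum_l\lambda'_l\bar\epsilon_l$, $v'^{(N)}_k=u'_k$, $t^{(l)}_{\lambda^{(l)}+a}:=t'^{(l)}_a$, $z_{m+k}:=z'_k$, and $\mathrm{Sym}^{(l)}$ is the sum over all permutations of the $\lambda^{(l)}+\lambda'^{(l)}$ variables $t^{(l)}_1,\dots,t^{(l)}_{\lambda^{(l)}+\lambda'^{(l)}}$; the product is extended bilinearly. **The subspace.** $\mathcal M^{+(n)}_\lambda(z^{(n)},\Pi_\lambda)=\mathrm{Span}_{\mathbb C}\{\widetilde W_I(t,z,\Pi):I\in\mathcal I_\lambda\}$, with $\widetilde W_I=W_I/H_\lambda$, $H_\lambda=\prod_{l=1}^{N-1}\prod_{a=1}^{\lambda^{(l)}}\prod_{b=1}^{\lambda^{(l+1)}}[v^{(l+1)}_b-v^{(l)}_a+1]$, $W_I=\mathrm{Sym}_{t^{(1)}}\cdots\mathrm{Sym}_{t^{(N-1)}}U_I$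 (sums over permutations), \begin{align*}U_I=\prod_{l=1}^{N-1}\prod_{a=1}^{\lambda^{(l)}}\Bigg(&\frac{[v^{(l+1)}_b-v^{(l)}_a+(P+h)_{\mu_s,l+1}-C_{\mu_s,l+1}(s)][1]}{[(P+h)_{\mu_s,l+1}-C_{\mu_s,l+1}(s)]}\Bigg|_{i^{(N)}_s=i^{(l+1)}_b=i^{(l)}_a}\\&\times\prod_{\substack{b=1\\ i^{(l+1)}_b>i^{(l)}_a}}^{\lambda^{(l+1)}}[v^{(l+1)}_b-v^{(l)}_a]\prod_{\substack{b=1\\ i^{(l+1)}_b<i^{(l)}_a}}^{\lambda^{(l+1)}}[v^{(l+1)}_b-v^{(l)}_a+1]\prod_{b=a+1}^{\lambda^{(l)}}\frac{[v^{(l)}_b-v^{(l)}_a+1]}{[v^{(l)}_b-v^{(l)}_a]}\Bigg)\end{align*} (in the first factor $b,s$ are determined by $i^{(N)}_s=s=i^{(l+1)}_b=i^{(l)}_a$). *)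

(* Defs.v *)
From HB Require Import structures.
From mathcomp Require Import all_boot all_order all_algebra perm complex.
From mathcomp Require Import all_classical all_reals all_analysis.

Set Implicit Arguments.
Unset Strict Implicit.
Unset Printing Implicit Defensive.

Import Order.TTheory GRing.Theory Num.Theory.
Import numFieldNormedType.Exports.

Local Open Scope classical_set_scope.
Local Open Scope ring_scope.

(* R[i] seen through numClosedFieldType, which is what gives it (and row
   vectors over it) the normed topology of MathComp-Analysis. *)
Definition cplx (R : realType) : numClosedFieldType := R[i].

Definition rc (R : realType) (x : R) : cplx R := Complex x 0.

Definition cexp (R : realType) (z : cplx R) : cplx R :=
  rc (expR (complex.Re z)) *
  (Complex (cos (complex.Im z)) (sin (complex.Im z)) : R[i]).

Section Theta.

Context (R : realType).
Local Notation C := (cplx R).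

Definition qpoch (x p : C) : C :=
  lim ((fun n : nat => \prod_(k < n) (1 - x * p ^+ k)) @ \oo).

Definition Theta (p z : C) : C := qpoch z p * qpoch (p / z) p * qpoch p p.

(* The branch of log q is a parameter lq, and q^x stands for exp (x log q). *)
Definition qpow (lq x : C) : C := cexp (x * lq).

Definition nome (lq : C) (r : R) : C := qpow lq (rc r *+ 2).

Definition br (lq : C) (r : R) (u : C) : C :=
  qpow lq (u ^+ 2 / rc r - u) * Theta (nome lq r) (qpow lq (u *+ 2)).

Definition twopii : C := rc pi *+ 2 * 'i.

(* 2 r log q = - 2 pi i / tau *)
Definition tau (lq : C) (r : R) : C := - twopii / (rc r * lq *+ 2).

End Theta.

Section Meromorphic.

Context (R : realType) (d : nat).
Local Notation C := (cplx R).
Local Notation V := 'rV[C]_d.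

(* Division is total, so a formula also takes (meaningless) values on its
   polar locus: meromorphic functions are represented by total functions, up
   to equality on a dense open set. *)
Definition generically (P : V -> Prop) : Prop :=
  exists O : set V, [/\ open O, dense O & forall v, O v -> P v].

Definition holomorphic_on (U : set V) (f : V -> C) : Prop :=
  forall v, U v -> differentiable f v.

(* Locally a quotient g / h of holomorphic functions, h vanishing nowhere on
   a dense open set. *)
Definition meromorphic (f : V -> C) : Prop :=
  forall v, exists U : set V, exists g h : V -> C,
    [/\ open U, U v, holomorphic_on U g, holomorphic_on U h &
      generically (fun w => U w -> h w != 0 /\ f w = g w / h w)].

End Meromorphic.

Section Weights.

Context (N : nat).

(* Labels 1, ..., N are the ordinals 0, ..., N-1: lambda_l is la (l-1), and
   the pair of labels (l, l+1) is (l-1, l). Levels keep their usual values,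
   so (l : 'I_N) also stands for the level l, whose upper label l+1 is the
   same ordinal l. Level 0 is empty since lev la 0 = 0, so products over
   (l < N) are products over 1 <= l <= N-1. *)
Definition weight := {ffun 'I_N -> nat}.

Definition lev (la : weight) (l : nat) : nat := \sum_(j < N | (j < l)%N) la j.

(* Number of variables t; the number of variables z is |la| = lev la N. *)
Definition tdim (la : weight) : nat := \sum_(l < N) lev la l.

(* mu stands for the partition I = (I_1, ..., I_N), I_l = {i | mu_i = l}. *)
Definition labelling (la : weight) := {ffun 'I_(lev la N) -> 'I_N}.

Definition parts (la : weight) : simpl_pred (labelling la) :=
  [pred mu : labelling la | [forall l, #|[pred i | mu i == l]| == la l]].

(* s = i^{(l)}_{a+1} with a = rank mu l s, when s belongs to I^{(l)}, i.e.
   when mu s < l. *)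
Definition rank (la : weight) (mu : labelling la) (l : nat)
    (s : 'I_(lev la N)) : nat :=
  #|[pred j | (mu j < l)%N && (j < s)%N]|.

End Weights.

Section Spaces.

Context (R : realType) (N : nat) (lq : cplx R) (r : R).
Local Notation C := (cplx R).
Local Notation W := (weight N).
Local Notation "[[ u ]]" := (br lq r u).

(* Dynamical parameters: P j k is (P+h)_{j,k}. *)
Definition dyn := 'M[C]_N.

(* Genericity: no denominator [(P+h)_{j,k} + m] of the weight functions
   vanishes. *)
Definition admissible (P : dyn) : Prop :=
  (forall j k l, P j k + P k l = P j l) /\
  (forall j k, j != k -> forall m : int, [[P j k + m%:~R]] != 0).

(* <epsbar_m, h_{j,k}> *)
Definition pairing (m j k : 'I_N) : C := (m == j)%:R - (m == k)%:R.

(* (P+h)_{j,k} |-> (P+h)_{j,k} - sum_l la_l <epsbar_l, h_{j,k}> *)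
Definition dynshift (P : dyn) (la : W) : dyn :=
  \matrix_(j, k) (P j k - \sum_l pairing l j k *+ la l).

(* The arguments are the v's (in the blocks v^{(0)}, ..., v^{(N-1)}, the first
   one being empty), the u's, and (P+h). [u] and the quasi-periods are not
   single-valued in q^{2u}, hence the additive variables. *)
Definition fct (la : W) := 'rV[C]_(tdim la) -> 'rV[C]_(lev la N) -> dyn -> C.

(* For fixed z and generic dynamical parameters, equality of meromorphic
   functions of t. *)
Definition feq (la : W) (F G : fct la) : Prop :=
  forall u P, admissible P -> generically (fun t => F t u P = G t u P).

Definition entry n (w : 'rV[C]_n) (a : nat) : C :=
  if insub a is Some i then w ord0 i else 0.

(* v^{(l)}_{a+1} for 0 < l < N, and u_{a+1} for l = N *)
Definition vcoord (la : W) (t : 'rV[C]_(tdim la)) (u : 'rV[C]_(lev la N))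
    (l a : nat) : C :=
  if insub l is Some k then entry (submxrow t (k : 'I_N)) a else entry u a.

Definition perms (la : W) := {dffun forall l : 'I_N, 'S_(lev la l)}.

Definition permt (la : W) (sg : perms la) (t : 'rV[C]_(tdim la)) :
    'rV[C]_(tdim la) :=
  \mxrow_(l < N) col_perm (sg l) (submxrow t l).

(* Sym^{(1)} ... Sym^{(N-1)} *)
Definition Sym (la : W) (f : 'rV[C]_(tdim la) -> C) (t : 'rV[C]_(tdim la)) : C :=
  \sum_(sg : perms la) f (permt sg t).

(* v^{(l)}_{a+1} |-> v^{(l)}_{a+1} + c *)
Definition translate (la : W) (l : 'I_N) (a : 'I_(lev la l)) (c : C)
    (t : 'rV[C]_(tdim la)) : 'rV[C]_(tdim la) :=
  t + c *: delta_mx ord0 (tagnat.Rank l a).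

Definition inM (la : W) (F : fct la) : Prop :=
  [/\ forall u P, admissible P -> meromorphic (fun t => F t u P),
      forall sg : perms la, feq (fun t => F (permt sg t)) F,
      forall (l : 'I_N) (a : 'I_(lev la l)),
        feq (fun t => F (translate a (rc r) t)) F,
      forall (j l : 'I_N) (a : 'I_(lev la l)), l = j.+1 :> nat ->
        feq (fun t => F (translate a (rc r * tau lq r) t))
            (fun t u P =>
               cexp (twopii R / rc r * (P j l - (la j)%:R)) * F t u P)
    & lev la N = 0%N -> exists c : C, feq F (fun _ _ _ => c)].

Section WeightFunctions.

Context (la : W).

(* C_{mu_s, l+1}(s) *)
Definition Cmu (mu : labelling la) (s : 'I_(lev la N)) (l : 'I_N) : C :=
  \sum_(j < lev la N | (s < j)%N) pairing (mu j) (mu s) l.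

(* The product over a (resp. b) is indexed by s = i^{(l)}_a in I^{(l)} (resp.
   j = i^{(l+1)}_b in I^{(l+1)}, or j = i^{(l)}_b in I^{(l)}). *)
Definition U_ (mu : labelling la) (t : 'rV[C]_(tdim la))
    (u : 'rV[C]_(lev la N)) (P : dyn) : C :=
  let v l s := vcoord t u l (rank mu l s) in
  \prod_(l < N) \prod_(s < lev la N | (mu s < l)%N)
   ([[v l.+1 s - v l s + P (mu s) l - Cmu mu s l]] * [[1]]
      / [[P (mu s) l - Cmu mu s l]]
    * (\prod_(j < lev la N | (mu j < l.+1)%N && (s < j)%N) [[v l.+1 j - v l s]])
    * (\prod_(j < lev la N | (mu j < l.+1)%N && (j < s)%N) [[v l.+1 j - v l s + 1]])
    * (\prod_(j < lev la N | (mu j < l)%N && (s < j)%N)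
         ([[v l j - v l s + 1]] / [[v l j - v l s]]))).

Definition H_ (t : 'rV[C]_(tdim la)) (u : 'rV[C]_(lev la N)) : C :=
  let v := vcoord t u in
  \prod_(l < N) \prod_(a < lev la l) \prod_(b < lev la l.+1)
    [[v l.+1 b - v l a + 1]].

Definition Wt (mu : labelling la) : fct la := fun t u P =>
  Sym (fun t => U_ mu t u P) t / H_ t u.

Definition inMplus (F : fct la) : Prop :=
  exists c : labelling la -> C,
    feq F (fun t u P => \sum_(mu : labelling la | mu \in parts la) c mu * Wt mu t u P).

End WeightFunctions.

(* Splitting of the variables for nu = la + la': in each level, the first
   lev la l variables, then the lev la' l following ones. *)
Definition tfst (nu la : W) (t : 'rV[C]_(tdim nu)) : 'rV[C]_(tdim la) :=
  \mxrow_(l < N) \row_(a < lev la l) entry (submxrow t l) a.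

Definition tsnd (nu la la' : W) (t : 'rV[C]_(tdim nu)) : 'rV[C]_(tdim la') :=
  \mxrow_(l < N) \row_(a < lev la' l) entry (submxrow t l) (lev la l + a).

Definition ufst (nu la : W) (u : 'rV[C]_(lev nu N)) : 'rV[C]_(lev la N) :=
  \row_(a < lev la N) entry u a.

Definition usnd (nu la la' : W) (u : 'rV[C]_(lev nu N)) : 'rV[C]_(lev la' N) :=
  \row_(a < lev la' N) entry u (lev la N + a).

Definition Xi (la la' : W) (t : 'rV[C]_(tdim la)) (u : 'rV[C]_(lev la N))
    (t' : 'rV[C]_(tdim la')) (u' : 'rV[C]_(lev la' N)) : C :=
  let v := vcoord t u in
  let v' := vcoord t' u' in
  \prod_(l < N) \prod_(a < lev la l)
    ((\prod_(b < lev la' l.+1)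
        ([[v' l.+1 b - v l a]] / [[v' l.+1 b - v l a + 1]]))
     * (\prod_(c < lev la' l)
        ([[v' l c - v l a + 1]] / [[v' l c - v l a]]))).

(* F * G; the target nu is meant to be la + la', and is kept as a separate
   argument so that the components of a graded product need no transport. *)
Definition star (nu la la' : W) (F : fct la) (G : fct la') : fct nu :=
  fun t u P =>
    (\prod_(l < N) ((lev la l)`! * (lev la' l)`!))%:R^-1 *
    Sym (fun t =>
      let t1 := tfst la t in let u1 := ufst la u in
      let t2 := tsnd la la' t in let u2 := usnd la la' u in
      F t1 u1 (dynshift P la') * G t2 u2 P * Xi t1 u1 t2 u2) t.

(* Elements of the direct sum over all la: families with finite support. *)
Definition gfamily := forall la : W, fct la.

Definition finitely_supported (x : gfamily) : Prop :=
  exists s : seq W, forall la, la \notin s -> feq (x la) (fun _ _ _ => 0).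

Definition inMgr (x : gfamily) : Prop :=
  finitely_supported x /\ forall la, inM (x la).

Definition inMplusgr (x : gfamily) : Prop :=
  finitely_supported x /\ forall la, inMplus (x la).

(* Bilinear extension: the component nu sums over all la <= nu, with
   la' = nu - la. *)
Definition starg (x y : gfamily) : gfamily := fun nu t u P =>
  \sum_(k : {dffun forall i : 'I_N, 'I_(nu i).+1})
    let la : W := [ffun i => k i : nat] in
    let la' : W := [ffun i => (nu i - k i)%N] in
    star (x la) (y la') t u P.

Definition subspace_of (S T : gfamily -> Prop) : Prop :=
  [/\ forall x, S x -> T x,
      S (fun _ _ _ _ => 0)
    & forall (c : C) x y, S x -> S y ->
        S (fun la t u P => c * x la t u P + y la t u P)].

End Spaces.

(* Main.v *)
Require Import Defs.
From mathcomp Require Import all_boot all_order all_algebra perm complex.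
From mathcomp Require Import all_classical all_reals all_analysis.
From mathcomp Require Import ring lra zify.

(** Let w^(l)_s denote the variable v^(l)_a with i^(l)_a = s.  The denominator
    H is symmetric, so each weight function is a symmetrization Sym (U_I / H),
    and U_I / H is a product, over the levels l and over pairs (s, j) of
    positions, of ratios [x + k] / [x] in which x is, up to an integer, a
    difference of two variables of the same level or of adjacent levels
    ([wnumer_div], [Utilde_wprod]).  Both halves of the theorem are read off
    this product.

    Closure under the star product.  Put the labelling I on the first m
    positions and I' on the last n.  In the product attached to the
    concatenation II', the pairs inside the first block give U_I / H with
    shifted dynamical parameters, because C(s) now also counts the labels of
    the second block; the pairs inside the second block give U_I' / H; the
    pairs with s in the first and j in the second block give Xi; the remaining
    pairs give factors [x + 1] / [x + 1], which are 1 for generic variables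
    ([wprod_cat], [Utilde_concat]).  As Xi is symmetric in each of the two
    groups of variables, expanding the two inner symmetrizations repeats every
    term of the outer one as many times as the factorials in the definition
    of the product.  Hence the product of the weight functions of I and I' is
    the weight function of II' on a dense open set ([star_Wt]), and
    bilinearity does the rest.

    Inclusion of the span in the big space.  A translation by r or by r tau
    multiplies [x] by a factor m(x) with m(x + k) = m(x) exp(- theta k), so
    that [x + k] / [x] is multiplied by exp(- theta k).  Adding up the
    exponents of the factors that contain a given variable of level l, all
    dependence on the labelling cancels and (P+h)_{l,l+1} - lambda_l remains
    ([exponentE], [Wt_translate]).

    Meromorphy rests on two facts about [u].  It is entire: the partial
    products f_n of (x; p) satisfy
    |f_n(y) - f_n(x) - (y - x) f_n'(x)| <= K |y - x|^2 with K independent of n,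
    an estimate that survives the limit ([differentiable_qpoch]).  And it does
    not vanish identically on any nonempty open set: at a zero, Re (u log q) is an integer multiple
    of r Re (log q), which a small real displacement of u avoids
    ([br_neq0_near]). *)

Set Implicit Arguments.
Unset Strict Implicit.
Unset Printing Implicit Defensive.

Import Order.TTheory GRing.Theory Num.Theory.
Import numFieldNormedType.Exports.

Local Open Scope ring_scope.

(** * Complex numbers and complex differentiability *)

Section ComplexAnalysis.
Local Open Scope classical_set_scope.
Context (R : realType).
Local Notation C := (cplx R).

Lemma rcE (x : R) : rc x = x%:C%C. Proof. by []. Qed.

Lemma rcD (x y : R) : rc (x + y) = rc x + rc y.
Proof. exact: (rmorphD (real_complex R)). Qed.

Lemma rcN (x : R) : rc (- x) = - rc x.
Proof. exact: (rmorphN (real_complex R)). Qed.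

Lemma rcM (x y : R) : rc (x * y) = rc x * rc y.
Proof. exact: (rmorphM (real_complex R)). Qed.

Lemma rcX (x : R) n : rc (x ^+ n) = rc x ^+ n.
Proof. exact: (rmorphXn (real_complex R)). Qed.

Lemma rc_nat n : rc n%:R = n%:R :> C.
Proof. exact: (rmorph_nat (real_complex R)). Qed.

Lemma rc0 : rc 0 = 0 :> C. Proof. by []. Qed.
Lemma rc1 : rc 1 = 1 :> C. Proof. by []. Qed.

Lemma rc_le (x y : R) : (rc x <= rc y) = (x <= y).
Proof. exact: lecR. Qed.

Lemma rc_lt (x y : R) : (rc x < rc y) = (x < y).
Proof. exact: ltcR. Qed.

Lemma rc_eq0 (x : R) : (rc x == 0) = (x == 0).
Proof. exact: (fmorph_eq0 (real_complex R)). Qed.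

Lemma rc_norm (x : R) : `|rc x| = rc `|x|.
Proof. by rewrite rcE normc_def /= expr0n addr0 sqrtr_sqr. Qed.

Lemma norm_rc (z : C) : `|z| = rc (complex.Re `|z|).
Proof. by rewrite rcE normc_def. Qed.

Lemma Re_normE (z : C) : complex.Re `|z| = Num.sqrt (complex.Re z ^+ 2 + complex.Im z ^+ 2).
Proof. by rewrite normc_def. Qed.

Lemma norm_Re_le (z : C) : `|complex.Re z| <= complex.Re `|z|.
Proof.
rewrite Re_normE -sqrtr_sqr ler_wsqrtr// lerDl; exact: sqr_ge0.
Qed.

Lemma norm_Im_le (z : C) : `|complex.Im z| <= complex.Re `|z|.
Proof.
rewrite Re_normE -sqrtr_sqr ler_wsqrtr// lerDr; exact: sqr_ge0.
Qed.

Lemma complex_split (z : C) : z = rc (complex.Re z) + 'i * rc (complex.Im z).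
Proof. by rewrite [LHS]complexE complexiE. Qed.

Lemma norm_le_ReIm (z : C) : `|z| <= rc (`|complex.Re z| + `|complex.Im z|).
Proof.
rewrite {1}(complex_split z) (le_trans (ler_normD _ _))//.
by rewrite normrM normCi mul1r !rc_norm -rcD.
Qed.

Lemma Re_sub (z w : C) : complex.Re (z - w) = complex.Re z - complex.Re w.
Proof. by case: z; case: w. Qed.

Lemma Im_sub (z w : C) : complex.Im (z - w) = complex.Im z - complex.Im w.
Proof. by case: z; case: w. Qed.

Lemma cvg_complex (u : nat -> C) (a b : R) :
  (fun n => complex.Re (u n)) @ \oo --> a -> (fun n => complex.Im (u n)) @ \oo --> b ->
  u @ \oo --> (Complex a b : C).
Proof.
move=> ha hb; apply/cvgrPdist_lt => e e0.
have [e' e'0 ->] : exists2 e' : R, 0 < e' & e = rc e'.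
  exists (complex.Re e).
    by move: e0; rewrite ltcE /= => /andP[].
  by apply/esym/RRe_real; rewrite realE ltW.
have e2 : 0 < e' / 2 by lra.
move/cvgrPdist_lt: ha => /(_ _ e2) ha; move/cvgrPdist_lt: hb => /(_ _ e2) hb.
near=> n.
have ha' : `|a - complex.Re (u n)| < e' / 2 by near: n; exact: ha.
have hb' : `|b - complex.Im (u n)| < e' / 2 by near: n; exact: hb.
apply: le_lt_trans (norm_le_ReIm _) _.
rewrite rc_lt Re_sub Im_sub /=; lra.
Unshelve. all: by end_near. Qed.

Lemma real_geo_cvg (u : nat -> R) (M a : R) : 0 <= a < 1 ->
  (forall n, `|u n.+1 - u n| <= M * a ^+ n) -> cvgn u.
Proof.
move=> /andP[a0 a1] hu.
have -> : u = (fun n => u 0%N + series (fun k => u k.+1 - u k) n).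
  by apply/funext => n; rewrite /series /= telescope_sumr// addrC subrK.
apply: is_cvgD; first exact: is_cvg_cst.
apply: normed_cvg; apply: (@series_le_cvg _ _ (geometric M a)).
- by move=> n /=.
- move=> n /=; exact: le_trans (normr_ge0 _) (hu n).
- by move=> n /=; exact: hu.
- by apply: is_cvg_geometric_series; rewrite ger0_norm.
Qed.

(** The real and imaginary parts are dominated by the same geometric sequence. *)
Lemma cplx_geo_cvg (u : nat -> C) (M a : R) : 0 <= a < 1 ->
  (forall n, `|u n.+1 - u n| <= rc (M * a ^+ n)) -> cvgn u.
Proof.
move=> ha hu.
have hR : cvgn (fun n => complex.Re (u n)).
  apply: (real_geo_cvg ha) => n; rewrite -Re_sub -rc_le.
  apply: le_trans (hu n); rewrite [leRHS]norm_rc rc_le; exact: norm_Re_le.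
have hI : cvgn (fun n => complex.Im (u n)).
  apply: (real_geo_cvg ha) => n; rewrite -Im_sub -rc_le.
  apply: le_trans (hu n); rewrite [leRHS]norm_rc rc_le; exact: norm_Im_le.
by apply: cvgP; exact: (cvg_complex hR hI).
Qed.

(** A quadratic remainder estimate is what passes to limits of sequences of
    functions, which is why differentiability is always proved through it. *)
Lemma differentiable_of_quadratic_bound (f : C -> C) (x D K : C) :
  (forall h, `|h| <= 1 -> `|f (x + h) - f x - h * D| <= K * `|h| ^+ 2) ->
  differentiable f x.
Proof.
move=> hf; apply/derivable1_diffP.
(* The bound at h = 1 forces K to be a nonnegative real number. *)
have K0 : 0 <= K.
  have := hf 1; rewrite normr1 expr1n mulr1 => /(_ (lexx _)); exact: le_trans.
apply/cvg_ex; exists D; apply/cvgrPdist_lt => e e0.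
have d0 : 0 < Num.min 1 (e / (K + 1)).
  have h1 : 0 < e / (K + 1) by rewrite divr_gt0// ltr_wpDl.
  by rewrite /Num.min; case: ifP.
have K1 : 0 < K + 1 by rewrite ltr_wpDl.
near=> h.
have h0 : h != 0 by near: h; exact: nbhs_dnbhs_neq.
have hd : `|h| <= 1 /\ `|h| * (K + 1) < e.
  have hh : `|h| < 1 /\ `|h| < e / (K + 1).
    split; near: h; apply: dnbhs0_lt => //.
    by rewrite divr_gt0.
  case: hh => h1 h2; split; first exact: ltW.
  by rewrite -ltr_pdivlMr.
case: hd => h1 h2.
have := hf h h1; rewrite scaler1.
set z := f (x + h) - f x => hz.
rewrite (_ : _ - f x = z); last by rewrite /z (addrC x h).
have -> : D - h^-1 *: z = - (h^-1 * (z - h * D)).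
  rewrite mulrBr mulrA mulVf// mul1r opprB; congr (_ - _).
rewrite normrN normrM normfV.
apply: (@le_lt_trans _ _ (`|h| * K)).
  rewrite ler_pdivrMl ?normr_gt0//.
  by rewrite (_ : _ * (_ * _) = K * `|h| ^+ 2)//; ring.
apply: le_lt_trans h2.
by rewrite ler_wpM2l// lerDl.
Unshelve. all: by end_near. Qed.

End ComplexAnalysis.

(** * The complex exponential *)

Section ComplexExp.
Context (R : realType).
Local Notation C := (cplx R).

(** The bound on c covers both signs of y at once. *)
Lemma mean_value0 (f df : R -> R) (y : R) : (forall x : R, is_derive x 1 f (df x)) ->
  exists2 c, `|c| <= `|y| & f y - f 0 = df c * y.
Proof.
move=> hf.
have cf : continuous f.
  by move=> x; apply/differentiable_continuous/derivable1_diffP; case: (hf x).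
case: (leP 0 y) => y0.
  have [|c] := @MVT_segment R f df 0 y y0 (fun x _ => hf x).
    exact: continuous_subspaceT.
  rewrite in_itv /= subr0 => /andP[c0 cy] ->; exists c => //.
  by rewrite !ger0_norm.
have [|c] := @MVT_segment R f df y 0 (ltW y0) (fun x _ => hf x).
  exact: continuous_subspaceT.
rewrite in_itv /= sub0r => /andP[cy c0] /eqP; rewrite mulrN -eqr_oppLR opprB => /eqP ->.
by exists c => //; rewrite !ler0_norm ?lerN2 // ltW.
Qed.

Lemma norm_sin_le (y : R) : `|sin y| <= `|y|.
Proof.
have [c _] := @mean_value0 sin cos y (fun x => is_derive_sin x).
by rewrite sin0 subr0 => ->; rewrite normrM ler_piMl// cos_max.
Qed.

Lemma norm_cosB1_le (y : R) : `|cos y - 1| <= `|y| ^+ 2.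
Proof.
have [c hc] := @mean_value0 cos (fun x => - sin x) y (fun x => is_derive_cos x).
rewrite cos0 => ->; rewrite normrM normrN expr2 ler_wpM2r//.
exact: le_trans (norm_sin_le c) hc.
Qed.

Lemma norm_sinB_le (y : R) : `|y| <= 1 -> `|sin y - y| <= `|y| ^+ 2.
Proof.
move=> y1.
have hd (x : R) : is_derive x 1 (fun t => sin t - t) (cos x - 1).
  by apply: is_deriveB.
have [c hc] := mean_value0 y hd.
rewrite sin0 subrr subr0 => ->; rewrite normrM expr2 ler_wpM2r//.
have c2 : `|c| ^+ 2 <= `|c| by rewrite expr2 ler_piMl// (le_trans hc).
exact: le_trans (le_trans (norm_cosB1_le c) c2) hc.
Qed.

(** The upper bounds come from 1 - x/2 <= exp (- x/2), squared; halving x keeps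
    1 - x/2 away from 0 on the whole interval |x| <= 1. *)
Lemma expRB_bound (x : R) : `|x| <= 1 ->
  expR x <= 4 /\ `|expR x - 1 - x| <= 4 * `|x| ^+ 2.
Proof.
rewrite ler_norml => /andP[xm x1].
have h1 := expR_ge1Dx x.
have y0 : 0 < expR (x / 2) := expR_gt0 _.
have ey : expR x = expR (x / 2) ^+ 2 by rewrite expr2 -expRD; congr expR; lra.
have h2 : expR (x / 2) * (1 - x / 2) <= 1.
  rewrite -[leRHS](expRxMexpNx_1 (x / 2)) ler_wpM2l ?expR_ge0//.
  exact: expR_ge1Dx.
have h3 : expR x * (1 - x / 2) ^+ 2 <= 1.
  by rewrite ey -exprMn exprn_ile1// mulr_ge0 ?ltW//; lra.
have E0 : 0 < expR x := expR_gt0 x.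
have h4 : 1 / 4 <= (1 - x / 2) ^+ 2 by nra.
have h5 : expR x * (1 / 4) <= expR x * (1 - x / 2) ^+ 2 by rewrite ler_wpM2l// ltW.
split; first by lra.
have E1 : 0 <= expR x - 1 - x by lra.
have h6 : (expR x - 1 - x) * (1 / 4) <= (expR x - 1 - x) * (1 - x / 2) ^+ 2.
  by rewrite ler_wpM2l.
have h7 : 0 <= x ^+ 2 * (1 + x) by rewrite mulr_ge0 ?sqr_ge0//; lra.
have h8 : (1 + x) * (1 - x / 2) ^+ 2 = 1 - 3 / 4 * x ^+ 2 + x ^+ 3 / 4 by field.
have h9 : x ^+ 2 * (1 + x) = x ^+ 2 + x ^+ 3 by ring.
rewrite ger0_norm// real_normK ?num_real//; lra.
Qed.

Lemma cexpD (x y : C) : cexp (x + y) = cexp x * cexp y.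
Proof.
case: x => a b; case: y => c d; rewrite /cexp /rc /=.
rewrite expRD cosD sinD; apply/eqP; rewrite eq_complex /=; apply/andP; split; apply/eqP; ring.
Qed.

Lemma cexp0 : cexp (0 : C) = 1.
Proof. by rewrite /cexp /= expR0 cos0 sin0 mul1r. Qed.

Lemma cexp_neq0 (x : C) : cexp x != 0.
Proof.
have h : cexp x * cexp (- x) = 1 by rewrite -cexpD subrr cexp0.
by apply/eqP => h0; move: h; rewrite h0 mul0r => /eqP; rewrite eq_sym oner_eq0.
Qed.

Lemma cexpN (x : C) : cexp (- x) = (cexp x)^-1.
Proof.
by apply: (mulfI (cexp_neq0 x)); rewrite -cexpD subrr cexp0 divff ?cexp_neq0.
Qed.

Lemma norm_cexp (x : C) : `|cexp x| = rc (expR (complex.Re x)).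
Proof.
case: x => a b; rewrite /cexp normrM rc_norm [X in _ * X](@norm_rc R) Re_normE /=.
by rewrite cos2Dsin2 sqrtr1 rc1 mulr1 ger0_norm ?expR_ge0.
Qed.

(** With h = x + iy and E = exp x, the real part of the remainder is
    (E - 1 - x) + E (cos y - 1), and its imaginary part is
    E (sin y - y) + (E - 1 - x) y + x y; every term is O(|h|^2). *)
Lemma cexp_near1 (h : C) : `|h| <= 1 -> `|cexp h - 1 - h| <= 17%:R * `|h| ^+ 2.
Proof.
case: h => x y h1.
set rho := complex.Re `|Complex x y : C|.
have hr : `|Complex x y : C| = rc rho by rewrite norm_rc.
have rho1 : rho <= 1 by move: h1; rewrite hr -rc1 rc_le.
have xr : `|x| <= rho := norm_Re_le (Complex x y).
have yr : `|y| <= rho := norm_Im_le (Complex x y).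
rewrite hr -rcX -rc_nat -rcM; apply: le_trans (norm_le_ReIm _) _; rewrite rc_le.
rewrite !Re_sub !Im_sub /=.
have [E4 hE] := expRB_bound (le_trans xr rho1).
have hc := norm_cosB1_le y.
have hs := norm_sinB_le (le_trans yr rho1).
have E0 := expR_ge0 x.
have r0 : 0 <= rho := le_trans (normr_ge0 _) xr.
have x2 : `|x| ^+ 2 <= rho ^+ 2 by rewrite ler_sqr ?nnegrE.
have y2 : `|y| ^+ 2 <= rho ^+ 2 by rewrite ler_sqr ?nnegrE.
set E := expR x in E4 hE E0 *; set c := cos y in hc *; set s := sin y in hs *.
have -> : E * c - 0 * s - 1 - x = (E - 1 - x) + E * (c - 1) by ring.
have -> : E * s + 0 * c - 0 - y = E * (s - y) + (E - 1 - x) * y + x * y by ring.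
have h3 : `|(E - 1 - x) + E * (c - 1)| <= 8 * rho ^+ 2.
  apply: le_trans (ler_normD _ _) _; rewrite normrM (ger0_norm E0).
  have : E * `|c - 1| <= 4 * rho ^+ 2 by apply: ler_pM => //; exact: le_trans y2.
  lra.
have h4 : `|E * (s - y) + (E - 1 - x) * y + x * y| <= 9 * rho ^+ 2.
  apply: le_trans (ler_normD _ _) _.
  apply: le_trans (lerD (ler_normD _ _) (lexx _)) _.
  rewrite !normrM (ger0_norm E0).
  have : E * `|s - y| <= 4 * rho ^+ 2 by apply: ler_pM => //; exact: le_trans y2.
  have : `|E - 1 - x| * `|y| <= 4 * rho ^+ 2.
    by rewrite -[leRHS]mulr1; apply: ler_pM => //; lra.
  have : `|x| * `|y| <= rho ^+ 2 by rewrite expr2; apply: ler_pM.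
  lra.
lra.
Qed.

Lemma differentiable_cexp (x : C) : differentiable (@cexp R : C -> C) x.
Proof.
apply: (@differentiable_of_quadratic_bound R _ x (cexp x) (`|cexp x| * 17%:R)) => h h1.
have -> : cexp (x + h) - cexp x - h * cexp x = cexp x * (cexp h - 1 - h).
  by rewrite cexpD; ring.
by rewrite normrM -mulrA ler_wpM2l// cexp_near1.
Qed.

End ComplexExp.

(** * The infinite product (x; p) *)

Section QPochhammer.
Local Open Scope classical_set_scope.
Context (R : realType).
Local Notation C := (cplx R).

(** Closed balls are closed; stated with a real radius because the order of the
    complex numbers is partial. *)
Lemma norm_lim_le (u : nat -> C) (l : C) (K : R) :
  u @ \oo --> l -> (forall n, `|u n| <= rc K) -> `|l| <= rc K.
Proof.
move=> hu hK; rewrite (norm_rc l) rc_le; apply/ler_addgt0Pr => e e0.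
have e0' : 0 < rc e :> C by rewrite -rc0 rc_lt.
move/cvgrPdist_lt: hu => /(_ _ e0') [n _ /(_ n (leqnn n)) /= hn].
rewrite -rc_le -norm_rc rcD addrC.
rewrite -[l in leLHS](subrK (u n)) (le_trans (ler_normD _ _))// lerD// ltW//.
Qed.

Lemma cplx_cvg_unique (u : nat -> C) (l l' : C) :
  u @ \oo --> l -> u @ \oo --> l' -> l = l'.
Proof. by move=> h h'; exact: (norm_cvg_unique h h'). Qed.

Variable (p : C).
Hypothesis p1 : `|p| < 1.

Let a : R := complex.Re `|p|.

Let na : `|p| = rc a. Proof. exact: norm_rc. Qed.

Let a01 : 0 <= a < 1.
Proof. by rewrite -rc_le -rc_lt -na rc1 rc0 p1 normr_ge0. Qed.

Let a0 : 0 <= a. Proof. by case/andP: a01. Qed.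
Let a1 : a < 1. Proof. by case/andP: a01. Qed.

Definition qpart (n : nat) (x : C) : C := \prod_(k < n) (1 - x * p ^+ k).

(** The derivative of the partial product, by the Leibniz rule. *)
Fixpoint dqpart (n : nat) (x : C) : C :=
  if n is m.+1 then dqpart m x * (1 - x * p ^+ m) - p ^+ m * qpart m x else 0.

Lemma qpartS n x : qpart n.+1 x = qpart n x * (1 - x * p ^+ n).
Proof. by rewrite /qpart big_ord_recr. Qed.

Lemma qpart0 x : qpart 0 x = 1.
Proof. by rewrite /qpart big_ord0. Qed.

Let geo_sum n : R := \sum_(k < n) a ^+ k.
Let majorant (M : R) n : R := \prod_(k < n) (1 + M * a ^+ k).

Let an0 n : 0 <= a ^+ n. Proof. exact: exprn_ge0. Qed.

Let geo_sumS n : geo_sum n.+1 = geo_sum n + a ^+ n. Proof. by rewrite /geo_sum big_ord_recr. Qed.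
Let majorantS M n : majorant M n.+1 = majorant M n * (1 + M * a ^+ n).
Proof. by rewrite /majorant big_ord_recr. Qed.

Let geo_sum_ge0 n : 0 <= geo_sum n. Proof. by apply: sumr_ge0 => *; exact: an0. Qed.

Let majorant_ge1 M n : 0 <= M -> 1 <= majorant M n.
Proof.
move=> M0; elim: n => [|n ih]; first by rewrite /majorant big_ord0.
by rewrite majorantS; apply: (le_trans ih); rewrite ler_peMr// ?lerDl ?mulr_ge0// (le_trans ler01).
Qed.

Let geo_sum_le n : geo_sum n <= (1 - a)^-1.
Proof.
have a1' : 0 < 1 - a by rewrite subr_gt0.
have h m : geo_sum m = (1 - a ^+ m) / (1 - a).
  elim: m => [|m ih]; first by rewrite /geo_sum big_ord0 expr0 subrr mul0r.
  rewrite geo_sumS ih exprS; field; lra.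
by rewrite h ler_piMl ?invr_ge0 ?(ltW a1')// gerBl.
Qed.

Let majorant_bound M := expR (M / (1 - a)).

Let majorant_le M n : 0 <= M -> majorant M n <= majorant_bound M.
Proof.
move=> M0; apply: (@le_trans _ _ (expR (M * geo_sum n))).
  elim: n => [|n ih]; first by rewrite /majorant /geo_sum !big_ord0 mulr0 expR0.
  rewrite majorantS geo_sumS [M * (geo_sum n + _)]mulrDr expRD; apply: ler_pM => //.
  - by apply: le_trans (majorant_ge1 _ M0).
  - by rewrite addr_ge0 // mulr_ge0.
  - exact: expR_ge1Dx.
by rewrite /majorant_bound ler_expR ler_wpM2l.
Qed.

Let norm_pn n : `|p ^+ n| = rc (a ^+ n).
Proof. by rewrite normrX na rcX. Qed.

Let factor_bound M n (x : C) : `|x| <= rc M -> `|1 - x * p ^+ n| <= rc (1 + M * a ^+ n).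
Proof.
move=> hx; rewrite rcD rcM rc1 (le_trans (ler_normB _ _))// normr1 lerD2l.
by rewrite normrM norm_pn ler_wpM2r// -rc0 rc_le.
Qed.

Let rc_ge0 (x : R) : 0 <= x -> 0 <= rc x :> C.
Proof. by rewrite -rc0 rc_le. Qed.

Let norm_ge (x : C) M : `|x| <= rc M -> 0 <= M.
Proof. by move=> h; rewrite -rc_le rc0 (le_trans _ h). Qed.

Let qpart_bound M n x : `|x| <= rc M -> `|qpart n x| <= rc (majorant M n).
Proof.
move=> hx; elim: n => [|n ih]; first by rewrite qpart0 normr1 /majorant big_ord0.
by rewrite qpartS majorantS rcM normrM; apply: ler_pM => //; exact: factor_bound.
Qed.

Let dqpart_bound M n x : `|x| <= rc M -> `|dqpart n x| <= rc (majorant M n * geo_sum n).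
Proof.
move=> hx; have M0 := norm_ge hx.
have E0 m : 0 <= majorant M m by exact: le_trans (majorant_ge1 _ M0).
elim: n => [|n ih] /=; first by rewrite normr0 rc_ge0// mulr_ge0.
apply: le_trans (ler_normB _ _) _; rewrite !normrM norm_pn.
apply: (@le_trans _ _ (rc (majorant M n * geo_sum n) * rc (1 + M * a ^+ n) + rc (a ^+ n) * rc
    (majorant M n))).
  apply: lerD; first by apply: ler_pM => //; exact: factor_bound.
  by rewrite ler_wpM2l ?rc_ge0// qpart_bound.
rewrite -!rcM -rcD rc_le majorantS geo_sumS -subr_ge0.
have -> : majorant M n * (1 + M * a ^+ n) * (geo_sum n + a ^+ n) -
   (majorant M n * geo_sum n * (1 + M * a ^+ n) + a ^+ n * majorant M n) = majorant M n * M * a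
       ^+ n * a ^+ n by ring.
by rewrite !mulr_ge0.
Qed.

Let qpart_lipschitz M n x y : `|x| <= rc M -> `|y| <= rc M ->
  `|qpart n y - qpart n x| <= `|y - x| * rc (majorant M n * geo_sum n).
Proof.
move=> hx hy; have M0 := norm_ge hx.
have E0 m : 0 <= majorant M m by exact: le_trans (majorant_ge1 _ M0).
elim: n => [|n ih]; first by rewrite !qpart0 subrr normr0 mulr_ge0// rc_ge0// mulr_ge0.
have -> : qpart n.+1 y - qpart n.+1 x =
   (qpart n y - qpart n x) * (1 - y * p ^+ n) - (y - x) * (p ^+ n * qpart n x).
  by rewrite !qpartS; ring.
apply: le_trans (ler_normB _ _) _; rewrite !normrM norm_pn.
apply: (@le_trans _ _ (`|y - x| * (rc (majorant M n * geo_sum n) * rc (1 + M * a ^+ n) + rc (a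
    ^+ n) * rc (majorant M n)))).
  rewrite mulrDr; apply: lerD.
    by rewrite mulrA; apply: ler_pM => //; exact: factor_bound.
  by rewrite ler_wpM2l// ler_wpM2l ?rc_ge0// qpart_bound.
rewrite ler_wpM2l// -!rcM -rcD rc_le majorantS geo_sumS -subr_ge0.
have -> : majorant M n * (1 + M * a ^+ n) * (geo_sum n + a ^+ n) -
   (majorant M n * geo_sum n * (1 + M * a ^+ n) + a ^+ n * majorant M n) = majorant M n * M * a
       ^+ n * a ^+ n by ring.
by rewrite !mulr_ge0.
Qed.

(** The remainder e_n of f_n satisfies
    e_(n+1) = e_n (1 - x p^n) - p^n (y - x) (f_n(y) - f_n(x)), so
    that it is bounded by the majorant of f_n times the square of the sum of the |p|^k,
    and both are bounded in n. *)
Let qpart_quadratic M n x y : `|x| <= rc M -> `|y| <= rc M ->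
  `|qpart n y - qpart n x - (y - x) * dqpart n x| <= `|y - x| ^+ 2 * rc (majorant M n * geo_sum
      n ^+ 2).
Proof.
move=> hx hy; have M0 := norm_ge hx.
have E0 m : 0 <= majorant M m by exact: le_trans (majorant_ge1 _ M0).
elim: n => [|n ih].
  rewrite !qpart0 subrr mulr0 subr0 normr0 mulr_ge0// ?exprn_ge0// rc_ge0//.
  by rewrite mulr_ge0// exprn_ge0.
have -> : qpart n.+1 y - qpart n.+1 x - (y - x) * dqpart n.+1 x =
   (qpart n y - qpart n x - (y - x) * dqpart n x) * (1 - x * p ^+ n)
   - p ^+ n * ((y - x) * (qpart n y - qpart n x)).
  by rewrite /= !qpartS; ring.
apply: le_trans (ler_normB _ _) _; rewrite !normrM norm_pn.
apply: (@le_trans _ _ (`|y - x| ^+ 2 * (rc (majorant M n * geo_sum n ^+ 2) * rc (1 + M * a ^+ n)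
         + rc (a ^+ n) * rc (majorant M n * geo_sum n)))).
  rewrite mulrDr; apply: lerD.
    by rewrite mulrA; apply: ler_pM => //; exact: factor_bound.
  rewrite [leRHS]mulrCA ler_wpM2l ?rc_ge0// expr2 -mulrA ler_wpM2l//; exact: qpart_lipschitz.
rewrite ler_wpM2l ?exprn_ge0// -!rcM -rcD rc_le majorantS geo_sumS -subr_ge0.
have -> : majorant M n * (1 + M * a ^+ n) * (geo_sum n + a ^+ n) ^+ 2 -
   (majorant M n * geo_sum n ^+ 2 * (1 + M * a ^+ n) + a ^+ n * (majorant M n * geo_sum n)) =
   majorant M n * a ^+ n * (geo_sum n + a ^+ n + M * a ^+ n * (2 * geo_sum n + a ^+ n)) by ring.
by rewrite !mulr_ge0// !addr_ge0// !mulr_ge0// addr_ge0// mulr_ge0.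
Qed.

(** Consecutive partial products differ by x p^n f_n(x), which is dominated by a
    geometric sequence. *)
Lemma qpart_cvg x : (fun n => qpart n x) @ \oo --> qpoch x p.
Proof.
pose M := complex.Re `|x|.
have hM : `|x| <= rc M by rewrite -norm_rc.
have M0 := norm_ge hM.
apply: (@cplx_geo_cvg R _ (M * majorant_bound M) a a01) => n.
have -> : qpart n.+1 x - qpart n x = - (x * qpart n x * p ^+ n) by rewrite qpartS; ring.
rewrite normrN !normrM norm_pn rcM ler_wpM2r ?rc_ge0// rcM ler_pM//.
by apply: le_trans (qpart_bound n hM) _; rewrite rc_le majorant_le.
Qed.

Let dqpart_cvg x : cvgn (fun n => dqpart n x).
Proof.
pose M := complex.Re `|x|.
have hM : `|x| <= rc M by rewrite -norm_rc.
have M0 := norm_ge hM.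
apply: (@cplx_geo_cvg R _ (M * (majorant_bound M * (1 - a)^-1) + majorant_bound M) a a01) => n.
have -> : dqpart n.+1 x - dqpart n x = - ((x * dqpart n x + qpart n x) * p ^+ n).
  by rewrite /=; ring.
rewrite normrN !normrM norm_pn rcM ler_wpM2r ?rc_ge0// rcD (le_trans (ler_normD _ _))//.
apply: lerD; last by apply: le_trans (qpart_bound n hM) _; rewrite rc_le majorant_le.
rewrite normrM rcM ler_pM//; apply: le_trans (dqpart_bound n hM) _; rewrite rc_le ler_pM//.
- exact: le_trans (majorant_ge1 _ M0).
- exact: majorant_le.
Qed.

Lemma differentiable_qpoch x : differentiable (fun x : C => qpoch x p : C) x.
Proof.
pose M := complex.Re `|x| + 1.
pose D := lim ((fun n => dqpart n x) @ \oo).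
have hM : `|x| <= rc M by rewrite rcD -norm_rc lerDl rc1.
have M0 := norm_ge hM.
apply: (@differentiable_of_quadratic_bound R _ x D (rc (majorant_bound M * (1 - a)^-1 ^+ 2)))
    => h h1.
have hM' : `|x + h| <= rc M.
  by rewrite rcD -norm_rc (le_trans (ler_normD _ _))// lerD2l.
rewrite (norm_rc h) -rcX -rcM; set rho := complex.Re `|h|.
have hc : (fun n => qpart n (x + h) - qpart n x - h * dqpart n x) @ \oo -->
    (qpoch (x + h) p - qpoch x p - h * D).
  apply: cvgB; first by apply: cvgB; exact: qpart_cvg.
  by apply: cvgM; [exact: cvg_cst|exact: dqpart_cvg].
apply: (norm_lim_le hc) => n.
have := qpart_quadratic n hM hM'; rewrite [x + h - x]addrAC subrr add0r => hb; apply: (le_trans hb).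
rewrite (norm_rc h) -rcX -rcM rc_le mulrC -/rho; apply: ler_wpM2r; first exact: sqr_ge0.
apply: ler_pM; rewrite ?exprn_ge0 ?majorant_le//; first exact: le_trans (majorant_ge1 _ M0).
by rewrite ler_sqr ?nnegrE// ?geo_sum_le// invr_ge0 subr_ge0 ltW.
Qed.

Lemma qpoch0 : qpoch 0 p = 1.
Proof.
apply: (cplx_cvg_unique (qpart_cvg (x := 0))).
rewrite (_ : (fun n => qpart n 0) = fun=> 1); first exact: cvg_cst.
by apply/funext => n; rewrite /qpart big1// => i _; rewrite mul0r subr0.
Qed.

Lemma qpochE x : qpoch x p = (1 - x) * qpoch (p * x) p.
Proof.
apply: (@cplx_cvg_unique (fun n => qpart n.+1 x)).
  by rewrite (cvg_shiftS (fun n => qpart n x)); exact: qpart_cvg.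
rewrite (_ : (fun n => qpart n.+1 x) = fun n => (1 - x) * qpart n (p * x)).
  by apply: cvgM; [exact: cvg_cst|exact: qpart_cvg].
apply/funext => n; rewrite /qpart big_ord_recl expr0 mulr1; congr (_ * _).
by apply: eq_bigr => i _; rewrite lift0 exprS; ring.
Qed.

Lemma qpoch_shift n x : qpoch x p = qpart n x * qpoch (x * p ^+ n) p.
Proof.
elim: n => [|n ih]; first by rewrite qpart0 mul1r expr0 mulr1.
by rewrite ih qpartS -mulrA [X in _ * X = _]qpochE exprS (mulrCA p).
Qed.

(** Splitting off n factors leaves the value of the product at x p^n, which tends to
    its value 1 at 0 by continuity, hence is nonzero for large n. *)
Lemma qpoch_neq0 x : (forall k, 1 - x * p ^+ k != 0) -> qpoch x p != 0.
Proof.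
move=> hx.
have hc : {for 0, continuous (fun x : C => qpoch x p : C)}.
  exact/differentiable_continuous/differentiable_qpoch.
have hp : (fun n => x * p ^+ n) @ \oo --> (0 : C).
  rewrite -[0 : C](mulr0 x); apply: cvgM; first exact: cvg_cst.
  apply/cvgrPdist_lt => e e0.
  have e0' : 0 < complex.Re e by move: e0; rewrite ltcE /= => /andP[].
  have ee : e = rc (complex.Re e) by apply/esym/RRe_real; rewrite realE ltW.
  have an : (fun n => a ^+ n) @ \oo --> 0 by apply: cvg_expr; rewrite ger0_norm.
  move/cvgrPdist_lt: an => /(_ _ e0'); apply: filterS => n.
  by rewrite !sub0r !normrN norm_pn ger0_norm// ee rc_lt.
have h : (fun n => qpoch (x * p ^+ n) p) @ \oo --> (1 : C).
  by rewrite -qpoch0; apply: (cvg_comp _ _ hp hc).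
move/cvgrPdist_lt: h => /(_ 1 ltr01) [n _ /(_ n (leqnn n)) /= hn].
rewrite (qpoch_shift n) mulf_neq0//.
  by apply/prodf_neq0 => i _.
by apply/eqP => h0; move: hn; rewrite h0 subr0 normr1 ltxx.
Qed.

End QPochhammer.

(** * The theta bracket [u] *)

Section Bracket.
Context (R : realType).
Local Notation C := (cplx R).
Variables (lq : C) (r : R).
Hypothesis hq : 0 < `|cexp lq| < 1.
Hypothesis hr : 0 < r.

Local Notation "[[ u ]]" := (br lq r u).

Let b := complex.Re lq.

Let b0 : b < 0.
Proof.
case/andP: hq => _; rewrite norm_cexp -rc1 rc_lt => h.
by rewrite ltNge; apply/negP => hb; move: h; rewrite -expR0 ltr_expR ltNge hb.
Qed.

Let lq0 : lq != 0.
Proof. by apply/eqP => h; move: b0; rewrite /b h ltxx. Qed.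

Let r0 : rc r != 0 :> C.
Proof. by rewrite rc_eq0 gt_eqF. Qed.

Let p := nome lq r.

Lemma Re_rcM (x : R) (z : C) : complex.Re (rc x * z) = x * complex.Re z.
Proof. by case: z => c d; rewrite /= mul0r subr0. Qed.

Let norm_p : `|p| = rc (expR (2 * r * b)).
Proof.
rewrite /p /nome /qpow norm_cexp; congr (rc (expR _)).
by rewrite -[rc r *+ 2]mulr_natl -rc_nat -rcM Re_rcM.
Qed.

Let p1 : `|p| < 1.
Proof.
rewrite norm_p -rc1 rc_lt -expR0 ltr_expR pmulr_rlt0// mulr_gt0//.
Qed.

Let p_neq0 : p != 0. Proof. exact: cexp_neq0. Qed.

(** Both (z; p) and (p/z; p) change by one factor, and (1 - 1/z) = - (1 - z) / z. *)
Lemma Theta_shift (z : C) : z != 0 -> Theta p (p * z) = - z^-1 * Theta p z.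
Proof.
move=> z0; rewrite /Theta.
have -> : p / (p * z) = z^-1 by field; rewrite z0 p_neq0.
rewrite (qpochE p1 z^-1) (qpochE p1 z); field.
exact: z0.
Qed.

Lemma cexp_twopii : cexp (twopii R) = 1.
Proof.
have -> : twopii R = Complex 0 (pi *+ 2).
  by rewrite [RHS]complex_split /= rc0 add0r mulr2n rcD -mulr2n mulrC.
by rewrite /cexp /= expR0 cos2pi sin2pi mulr1.
Qed.

Lemma br_add_r u : [[u + rc r]] = - [[u]].
Proof.
have hz : qpow lq ((u + rc r) *+ 2) = p * qpow lq (u *+ 2).
  by rewrite /p /nome /qpow -cexpD; congr cexp; ring.
have he : qpow lq ((u + rc r) ^+ 2 / rc r - (u + rc r)) =
    qpow lq (u ^+ 2 / rc r - u) * qpow lq (u *+ 2).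
  by rewrite /qpow -cexpD; congr cexp; field.
have z0 : qpow lq (u *+ 2) != 0 := cexp_neq0 _.
rewrite /br hz Theta_shift// he -/p; field.
exact: z0.
Qed.

Let T := rc r * tau lq r.

Let T_lq : T * lq = - twopii R / 2.
Proof. by rewrite /T /tau; field; rewrite lq0 r0. Qed.

(** Since r tau log q = - pi i, the argument q^(2u) of the theta function is unchanged,
    and only the Gaussian prefactor contributes. *)
Lemma br_add_rtau u :
  [[u + T]] = cexp ((T / rc r - 1) * (T * lq) - twopii R / rc r * u) * [[u]].
Proof.
have hz : qpow lq ((u + T) *+ 2) = qpow lq (u *+ 2).
  rewrite /qpow.
  have -> : (u + T) *+ 2 * lq = u *+ 2 * lq + (T * lq) *+ 2 by ring.
  rewrite T_lq (_ : (- twopii R / 2) *+ 2 = - twopii R); last by field.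
  by rewrite cexpD cexpN cexp_twopii invr1 mulr1.
rewrite /br hz mulrA; congr (_ * _).
rewrite /qpow -cexpD; congr cexp.
have -> : ((u + T) ^+ 2 / rc r - (u + T)) * lq =
  (u ^+ 2 / rc r - u) * lq + (T / rc r - 1) * (T * lq) + (u / rc r *+ 2) * (T * lq).
  by field.
rewrite T_lq; field; exact: r0.
Qed.

(** The property of a translation by c which the ratios [x + k] / [x] see; it treats
    the periods r (theta = 0) and r tau (theta = 2 pi i / r) uniformly. *)
Definition quasi_period (c theta : C) := exists m : C -> C,
  [/\ forall u, m u != 0, forall u, [[u + c]] = m u * [[u]]
    & forall u k, m (u + k) = m u * cexp (- (theta * k))].

Lemma quasi_period_r : quasi_period (rc r) 0.
Proof.
exists (fun=> -1); split=> [u|u|u k].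
- by rewrite oppr_eq0 oner_eq0.
- by rewrite br_add_r mulN1r.
- by rewrite mul0r oppr0 cexp0 mulr1.
Qed.

Lemma quasi_period_rtau : quasi_period (rc r * tau lq r) (twopii R / rc r).
Proof.
exists (fun u => cexp ((T / rc r - 1) * (T * lq) - twopii R / rc r * u)).
split=> [u|u|u k]; first exact: cexp_neq0.
- exact: br_add_rtau.
- by rewrite -cexpD; congr cexp; ring.
Qed.

(** In a difference of two variables either of them, or both, or none may be the
    translated one; the booleans b1 and b2 record which. *)
Lemma quasi_period_ratio c theta : quasi_period c theta ->
  forall (x k : C) (b1 b2 : bool),
  [[x + c * (b1%:R - b2%:R) + k]] / [[x + c * (b1%:R - b2%:R)]] =
  cexp (theta * k * (b2%:R - b1%:R)) * ([[x + k]] / [[x]]).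
Proof.
case=> m [m0 hm mk].
have h x k : [[x + c + k]] / [[x + c]] = cexp (- (theta * k)) * ([[x + k]] / [[x]]).
  rewrite (addrAC x c k) !hm mk invfM; move: (m0 x) => /divff mx.
  rewrite [RHS]mulrA -[RHS]mul1r -mx; ring.
move=> x k [] [] /=; rewrite ?subrr ?mulr0 ?addr0 ?cexp0 ?mul1r ?subr0 ?sub0r ?mulr1 ?mulrN1 //.
have := h (x - c) k; rewrite subrK => ->.
by rewrite mulrA -cexpD subrr cexp0 mul1r.
Qed.

Lemma differentiable_comp1 (V : normedModType C) (f : V -> C) (g : C -> C) x :
  differentiable f x -> (forall y, differentiable g y) -> differentiable (fun v => g (f v)) x.
Proof. by move=> hf hg; exact: differentiable_comp. Qed.

Lemma differentiable_br u : differentiable (br lq r : C -> C) u.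
Proof.
have hid y : differentiable (fun v : C => v) y by exact: ex_diff.
have hc a y : differentiable (fun v : C => a : C) y by exact: differentiable_cst.
have hT y : differentiable (fun v : C => v *+ 2 * lq) y.
  rewrite (_ : (fun v : C => v *+ 2 * lq) = fun v => v * (lq *+ 2)).
    exact: differentiableM.
  by apply/funext => v; ring.
have he f y : (forall y, differentiable (f : C -> C) y) ->
    differentiable (fun v : C => cexp (f v) : C) y.
  by move=> hf; exact: (differentiable_comp1 (hf y) (@differentiable_cexp R)).
have hq' f y : (forall y, differentiable (f : C -> C) y) ->
    differentiable (fun v : C => qpoch (f v) p : C) y.
  by move=> hf; exact: (differentiable_comp1 (hf y) (differentiable_qpoch p1)).
rewrite (_ : br lq r = fun v => cexp ((v ^+ 2 * (rc r)^-1 - v) * lq) *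
   (qpoch (cexp (v *+ 2 * lq)) p * qpoch (p * cexp (- (v *+ 2 * lq))) p * qpoch p p)).
  apply: differentiableM.
    apply: (he (fun v => (v ^+ 2 * (rc r)^-1 - v) * lq)) => y.
    apply: differentiableM; last exact: hc.
    apply: differentiableB; last exact: hid.
    by apply: differentiableM => //; exact: differentiableX.
  apply: differentiableM; last exact: hc.
  apply: differentiableM.
    by apply: (hq' (fun v => cexp (v *+ 2 * lq))) => y; apply: he.
  apply: (hq' (fun v => p * cexp (- (v *+ 2 * lq)))) => y.
  apply: differentiableM; first exact: hc.
  apply: (he (fun v => - (v *+ 2 * lq))) => z; exact: differentiableN.
by apply/funext => v; rewrite /br /Theta /qpow cexpN.
Qed.

(** A zero of [u] comes from a vanishing factor 1 - q^(2u) p^k or 1 - q^(-2u) p^(k+1);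
    taking absolute values turns this into a condition on Re (u log q). *)
Lemma br_neq0 u : (forall n : int, complex.Re (u * lq) != n%:~R * (r * b)) -> [[u]] != 0.
Proof.
move=> hu; set A := complex.Re (u * lq) in hu.
have npn k : `|p ^+ k| = rc (expR (k%:R * (2 * r * b))).
  by rewrite normrX norm_p -rcX -expRM_natl.
have nz (e : R) : `|cexp (rc e * (u *+ 2 * lq))| = rc (expR (e * (2 * A))).
  rewrite norm_cexp Re_rcM; congr (rc (expR (_ * _))).
  have -> : u *+ 2 * lq = rc 2 * (u * lq) by rewrite rc_nat; ring.
  by rewrite Re_rcM.
have key (z : C) (x : R) : `|z| = rc (expR x) -> x != 0 -> 1 - z != 0.
  move=> hz; apply: contra; rewrite subr_eq0 => /eqP hz1.
  move: hz; rewrite -hz1 normr1 -rc1 => /eqP; rewrite -subr_eq0 -rcN -rcD rc_eq0 subr_eq0.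
  by rewrite -expR0 => /eqP /expR_inj <-.
rewrite /br mulf_neq0 ?cexp_neq0// /Theta -/p !mulf_neq0//.
- apply: (qpoch_neq0 p1) => k.
  apply: (key _ (2 * A + k%:R * (2 * r * b))).
    rewrite normrM npn expRD rcM; congr (_ * _).
    by rewrite /qpow -[_ * lq]mul1r -rc1 nz mul1r.
  apply: contra (hu (- k%:Z)) => /eqP h; apply/eqP.
  by rewrite rmorphN /= -pmulrn; lra.
- apply: (qpoch_neq0 p1) => k.
  apply: (key _ (-1 * (2 * A) + k.+1%:R * (2 * r * b))).
    rewrite mulrAC -exprS mulrC normrM npn expRD rcM; congr (_ * _).
    by rewrite /qpow -cexpN -nz rcN rc1 mulN1r.
  apply: contra (hu (k.+1%:Z)) => /eqP h; apply/eqP.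
  by rewrite -pmulrn; lra.
- apply: (qpoch_neq0 p1) => k; rewrite -exprS; apply: (key _ _ (npn _)).
  rewrite !mulf_neq0 ?pnatr_eq0//; first by rewrite gt_eqF.
  by rewrite lt_eqF.
Qed.

(** Two candidate displacements, d/2 and d/3 with d <= r, cannot both be bad: their
    difference would be a nonzero integer multiple of r smaller than r. *)
Lemma br_neq0_near u (e : R) : 0 < e -> exists s, 0 < s < e /\ [[u + rc s]] != 0.
Proof.
move=> e0.
pose d := Num.min e r.
have d0 : 0 < d by rewrite lt_min e0 hr.
have [de dr] : d <= e /\ d <= r by rewrite !ge_min !lexx orbT.
have [h|] := pselect (forall n : int, complex.Re ((u + rc (d / 2)) * lq) != n%:~R * (r * b)).
  by exists (d / 2); split; [apply/andP; split; lra|exact: br_neq0].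
move=> /existsNP [n /negP]; rewrite negbK => /eqP hn.
exists (d / 3); split; first by apply/andP; split; lra.
apply: br_neq0 => m; apply/eqP => hm.
move: hn hm; rewrite !mulrDl.
have hRe (x y : C) : complex.Re (x + y) = complex.Re x + complex.Re y by case: x; case: y.
rewrite !hRe !Re_rcM -/b => hn hm.
have h1 : d / 6 * b = (n - m)%:~R * r * b by rewrite rmorphB /=; lra.
have h2 : d / 6 = (n - m)%:~R * r by apply: (mulIf (ltr0_neq0 b0)).
have nm0 : (0 : R) < (n - m)%:~R by rewrite -(pmulr_lgt0 _ hr) -h2; lra.
have nm1 : (n - m)%:~R < (1 : R) by rewrite -(ltr_pM2r hr) mul1r -h2; lra.
by move: nm0 nm1; rewrite ltr0z gtz0_ge1 ltNge ler1z => ->.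
Qed.

End Bracket.

(** * Generic points and quotients of entire functions *)

Section Generic.
Local Open Scope classical_set_scope.
Context (R : realType).
Local Notation C := (cplx R).

Lemma generically_mono d (P Q : 'rV[C]_d -> Prop) :
  (forall v, P v -> Q v) -> generically P -> generically Q.
Proof. by move=> PQ [W [oW dW WP]]; exists W; split=> // v /WP /PQ. Qed.

Lemma generically_all d (P : 'rV[C]_d -> Prop) : (forall v, P v) -> generically P.
Proof.
move=> hP; exists setT; split=> //; first exact: openT.
by move=> U [x Ux] _; exists x.
Qed.

Lemma generically_and d (P Q : 'rV[C]_d -> Prop) :
  generically P -> generically Q -> generically (fun v => P v /\ Q v).
Proof.
move=> [W [oW dW WP]] [W' [oW' dW' WP']]; exists (W `&` W'); split.
- exact: openI.
- move=> U U0 oU; rewrite setIA; apply: dW'; last exact: openI.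
  exact: dW.
- by move=> v [/WP ? /WP' ?].
Qed.

Lemma generically_seq d (I : eqType) (s : seq I) (P : I -> 'rV[C]_d -> Prop) :
  (forall i, i \in s -> generically (P i)) ->
  generically (fun v => forall i, i \in s -> P i v).
Proof.
elim: s => [|a s ih] h; first by apply: generically_all.
have ha := h a (mem_head _ _).
have hs : forall i, i \in s -> generically (P i).
  by move=> i si; apply: h; rewrite inE si orbT.
apply: generically_mono (generically_and ha (ih hs)) => v [Pa Ps] i.
by rewrite inE => /predU1P[->|/Ps].
Qed.

Lemma generically_fin d (I : finType) (P : I -> 'rV[C]_d -> Prop) :
  (forall i, generically (P i)) -> generically (fun v => forall i, P i v).
Proof.
move=> h; apply: generically_mono (@generically_seq _ _ (enum I) P (fun i _ => h i)).
by move=> v hv i; apply: hv; rewrite mem_enum.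
Qed.

Lemma open_nonexpansive d e (g : 'rV[C]_d -> 'rV[C]_e) (U : set 'rV[C]_e) :
  (forall x y (eps : C), ball x eps y -> ball (g x) eps (g y)) -> open U -> open (g @^-1` U).
Proof.
move=> hg; rewrite !openE => oU x /= /oU; rewrite /interior -nbhs_ballE => -[eps eps0 hU].
rewrite -nbhs_ballE; exists eps => // y /hg; exact: hU.
Qed.

(** Permutations of the variables, translations and the two projections attached to a
    splitting of the variables are all of this form. *)
Definition coord_selection d e (f : 'rV[C]_d -> 'rV[C]_e) := exists (s : 'I_e -> 'I_d) (c :
    'I_e -> C),
  injective s /\ forall t j, f t ord0 j = t ord0 (s j) + c j.

(** The preimage of a dense set is dense because any small change of f(t) lifts to an
    equally small change of the selected coordinates of t. *)
Lemma generically_selection d e (f : 'rV[C]_d -> 'rV[C]_e) (P : 'rV[C]_e -> Prop) :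
  coord_selection f -> generically P -> generically (fun t => P (f t)).
Proof.
move=> [s [c [sI fE]]] [W [oW dW WP]].
exists (f @^-1` W); split=> [||t /WP//].
  apply: open_nonexpansive => // x y eps [eps0 hxy]; split=> // i j.
  have := hxy i (s j); rewrite (ord1 i) !fE /ball /= /ball_ /=.
  by rewrite opprD addrACA subrr addr0.
move=> U [t Utilde] oU.
(* g lifts y to the point that agrees with t in the other coordinates. *)
pose g (y : 'rV[C]_e) : 'rV[C]_d :=
  \row_i (if [pick j | s j == i] is Some j then y ord0 j - c j else t ord0 i).
have gs y j : g y ord0 (s j) = y ord0 j - c j.
  rewrite mxE; case: pickP => [k /eqP /sI -> //|/(_ j)]; by rewrite eqxx.
have fg y : f (g y) = y.
  by apply/rowP => j; rewrite fE gs subrK.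
have gft : g (f t) = t.
  apply/rowP => i; rewrite mxE; case: pickP => // j /eqP <-; by rewrite fE addrK.
have [||y [/= Uy Wy]] := dW (g @^-1` U).
- by exists (f t) => /=; rewrite gft.
- apply: open_nonexpansive => // x y eps [eps0 hxy]; split=> // i k; rewrite !mxE.
  case: pickP => [j _|_]; last exact: ballxx.
  have := hxy ord0 j; rewrite /ball /= /ball_ /=.
  by rewrite opprB addrA subrK.
by exists (g y); split=> //=; rewrite fg.
Qed.

(** Satisfied by a difference of two distinct coordinates.  It allows a zero of [A(v)]
    to be left by moving one coordinate. *)
Definition unit_speed d (A : 'rV[C]_d -> C) := exists (i : 'I_d) (b : bool),
  forall v s, A (v + s *: delta_mx ord0 i) = A v + (-1) ^+ b * s.

Lemma ball_delta d (v : 'rV[C]_d) (i : 'I_d) (s eps : C) :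
  `|s| < eps -> ball v eps (v + s *: delta_mx ord0 i).
Proof.
move=> hs; have e0 : 0 < eps by apply: le_lt_trans hs.
split=> // a j; rewrite /ball /= /ball_ /= !mxE opprD addrA subrr sub0r normrN.
by case: (_ && _); rewrite ?mulr1// mulr0 normr0.
Qed.

(** Meromorphic functions with a global denominator.  Unlike the local notion they
    are obviously closed under sums and products. *)
Definition entire_quotient d (f : 'rV[C]_d -> C) := exists g h : 'rV[C]_d -> C,
  [/\ forall v, differentiable g v, forall v, differentiable h v &
      generically (fun v => h v != 0 /\ f v = g v / h v)].

Lemma entire_quotient_entire d (f : 'rV[C]_d -> C) : (forall v, differentiable f v) ->
    entire_quotient f.
Proof.
move=> hf; exists f, (fun=> 1); split=> //.
apply: generically_all => v; split; [exact: oner_neq0|by rewrite divr1].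
Qed.

Lemma entire_quotient_cst d (c : C) : entire_quotient (fun _ : 'rV[C]_d => c).
Proof. apply: entire_quotient_entire => v; exact: differentiable_cst. Qed.

Lemma entire_quotientM d (f1 f2 : 'rV[C]_d -> C) :
  entire_quotient f1 -> entire_quotient f2 -> entire_quotient (fun v => f1 v * f2 v).
Proof.
move=> [g1 [h1 [dg1 dh1 H1]]] [g2 [h2 [dg2 dh2 H2]]].
exists (fun v => g1 v * g2 v), (fun v => h1 v * h2 v).
split=> [v|v|]; [exact: differentiableM|exact: differentiableM|].
apply: generically_mono (generically_and H1 H2) => v [[h10 ->] [h20 ->]].
by split; [rewrite mulf_neq0|rewrite mulf_div].
Qed.

Lemma entire_quotientD d (f1 f2 : 'rV[C]_d -> C) :
  entire_quotient f1 -> entire_quotient f2 -> entire_quotient (fun v => f1 v + f2 v).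
Proof.
move=> [g1 [h1 [dg1 dh1 H1]]] [g2 [h2 [dg2 dh2 H2]]].
exists (fun v => g1 v * h2 v + g2 v * h1 v), (fun v => h1 v * h2 v).
split=> [v|v|].
- by apply: differentiableD; exact: differentiableM.
- exact: differentiableM.
apply: generically_mono (generically_and H1 H2) => v [[h10 ->] [h20 ->]].
by split; [rewrite mulf_neq0|rewrite addf_div].
Qed.

Lemma entire_quotient_sum d (I : Type) (s : seq I) (P : pred I) (f : I -> 'rV[C]_d -> C) :
  (forall i, P i -> entire_quotient (f i)) -> entire_quotient (fun v => \sum_(i <- s | P i) f i v).
Proof.
move=> hf; elim: s => [|i s ih].
  rewrite (_ : (fun v => _) = fun=> 0); first exact: entire_quotient_cst.
  by apply/funext => v; rewrite big_nil.
case Pi : (P i); last first.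
  rewrite (_ : (fun v => _) = fun v => \sum_(i <- s | P i) f i v)//.
  by apply/funext => v; rewrite big_cons Pi.
rewrite (_ : (fun v => _) = fun v => f i v + \sum_(i <- s | P i) f i v).
  by apply: entire_quotientD => //; exact: hf.
by apply/funext => v; rewrite big_cons Pi.
Qed.

Lemma entire_quotient_prod d (I : Type) (s : seq I) (P : pred I) (f : I -> 'rV[C]_d -> C) :
  (forall i, P i -> entire_quotient (f i)) -> entire_quotient (fun v => \prod_(i <- s | P i) f i v).
Proof.
move=> hf; elim: s => [|i s ih].
  rewrite (_ : (fun v => _) = fun=> 1); first exact: entire_quotient_cst.
  by apply/funext => v; rewrite big_nil.
case Pi : (P i); last first.
  rewrite (_ : (fun v => _) = fun v => \prod_(i <- s | P i) f i v)//.
  by apply/funext => v; rewrite big_cons Pi.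
rewrite (_ : (fun v => _) = fun v => f i v * \prod_(i <- s | P i) f i v).
  by apply: entire_quotientM => //; exact: hf.
by apply/funext => v; rewrite big_cons Pi.
Qed.

Lemma entire_quotient_meromorphic d (f f' : 'rV[C]_d -> C) :
  entire_quotient f -> generically (fun v => f' v = f v) -> meromorphic f'.
Proof.
move=> [g [h [dg dh H]]] hf v; exists setT, g, h; split=> //.
- exact: openT.
- by apply: generically_mono (generically_and H hf) => w [[h0 fE] ->] _.
Qed.

Variables (lq : C) (r : R).
Hypothesis hq : 0 < `|cexp lq| < 1.
Hypothesis hr : 0 < r.

(** The nonvanishing locus is open by continuity and dense by moving one coordinate. *)
Lemma generically_br d (A : 'rV[C]_d -> C) : (forall v, differentiable A v) -> unit_speed A ->
  generically (fun v => br lq r (A v) != 0).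
Proof.
move=> dA [i [b hA]].
have dB v : differentiable (fun v => br lq r (A v)) v.
  exact: (differentiable_comp1 (dA v) (differentiable_br hq hr)).
exists [set v | br lq r (A v) != 0]; split=> //.
  have cB : continuous (fun v => br lq r (A v)).
    by move=> v; exact/differentiable_continuous.
  apply: (@open_comp _ _ (fun v => br lq r (A v)) [set z | z != 0]).
    by move=> v _; exact: cB.
  rewrite openE => z /= z0; rewrite /interior -nbhs_ballE; exists `|z|.
    by rewrite /= normr_gt0.
  move=> y /=; rewrite /ball /= => hy; apply/eqP => y0.
  by move: hy; rewrite y0 subr0 ltxx.
move=> U [v Uv]; rewrite openE => /(_ _ Uv); rewrite /interior -nbhs_ballE => -[eps /= eps0 hU].
have e0' : 0 < complex.Re eps by move: eps0; rewrite ltcE /= => /andP[].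
have [s [/andP[s0 se] hs]] := br_neq0_near hq hr (A v) e0'.
exists (v + ((-1) ^+ b * rc s) *: delta_mx ord0 i); split.
  apply: hU; apply: ball_delta; rewrite normrM normrX normrN normr1 expr1n mul1r.
  rewrite rc_norm gtr0_norm//.
  by rewrite (_ : eps = rc (complex.Re eps)) ?rc_lt//; apply/esym/RRe_real; rewrite realE ltW.
by rewrite /= hA mulrA -expr2 sqrr_sign mul1r.
Qed.

Lemma entire_quotient_br d (A : 'rV[C]_d -> C) : (forall v, differentiable A v) ->
  entire_quotient (fun v => br lq r (A v)).
Proof.
move=> dA; apply: entire_quotient_entire => v.
exact: (differentiable_comp1 (dA v) (differentiable_br hq hr)).
Qed.

Lemma entire_quotient_brV d (A : 'rV[C]_d -> C) : (forall v, differentiable A v) -> unit_speed A ->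
  entire_quotient (fun v => (br lq r (A v))^-1).
Proof.
move=> dA uA; exists (fun=> 1), (fun v => br lq r (A v)); split=> [v|v|].
- exact: differentiable_cst.
- exact: (differentiable_comp1 (dA v) (differentiable_br hq hr)).
- by apply: generically_mono (generically_br dA uA) => v h; rewrite mul1r.
Qed.

End Generic.

(** * Ranks of positions and the product form of the weight functions *)

Section Rank.

(** If s lies in I^(l), then s = i^(l)_a with a = rk m l s, counted from 0.  Labels
    and positions are natural numbers, so that labellings can be concatenated without
    casts between ordinals. *)
Definition rk (m : nat -> nat) (l s : nat) : nat := \sum_(j < s) (m j < l)%N.

Lemma rkS m l s : rk m l s.+1 = (rk m l s + (m s < l))%N.
Proof. by rewrite /rk big_ord_recr. Qed.

Lemma rk_leq m l s s' : (s <= s')%N -> (rk m l s <= rk m l s')%N.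
Proof.
elim: s' => [|s' ih]; first by rewrite leqn0 => /eqP ->.
by rewrite leq_eqVlt ltnS => /predU1P[->//|/ih h]; rewrite rkS (leq_trans h)// leq_addr.
Qed.

Lemma rk_ltn m l s s' : (s < s')%N -> (m s < l)%N -> (rk m l s < rk m l s')%N.
Proof.
by move=> ss' ms; apply: leq_trans (rk_leq m l ss'); rewrite rkS ms addn1.
Qed.

Lemma rk_inj m l s s' : (m s < l)%N -> (m s' < l)%N -> rk m l s = rk m l s' -> s = s'.
Proof.
move=> ms ms' h; case: (ltngtP s s') => // ss'.
  by have := rk_ltn ss' ms; rewrite h ltnn.
by have := rk_ltn ss' ms'; rewrite h ltnn.
Qed.

Lemma rk_surj m l n a : (a < rk m l n)%N -> exists s, [/\ (s < n)%N, (m s < l)%N & rk m l s = a].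
Proof.
elim: n => [|n ih]; first by rewrite /rk big_ord0.
rewrite rkS; case: (ltnP a (rk m l n)) => [/ih [s [sn ms <-]] _|le_a].
  by exists s; split=> //; exact: ltnW.
case ml : (m n < l)%N; last by rewrite addn0 ltnNge le_a.
rewrite addn1 ltnS => ge_a; exists n; split=> //.
by apply/eqP; rewrite eqn_leq le_a ge_a.
Qed.

(** The positions with label below l are enumerated increasingly by their ranks. *)
Lemma prod_rk (A : comPzRingType) (m : nat -> nat) l n (F : nat -> A) :
  \prod_(s < n | (m s < l)%N) F (rk m l s) = \prod_(a < rk m l n) F a.
Proof.
elim: n => [|n ih]; first by rewrite /rk !big_ord0.
rewrite big_mkcond big_ord_recr -big_mkcond /= ih rkS.
by case: ifP => _; rewrite ?addn1 ?addn0 ?big_ord_recr ?mulr1.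
Qed.

Lemma big_prod3 (A : comPzRingType) (I : finType) (P : pred I) (F G H : I -> A) :
  \prod_(i | P i) (F i * G i * H i) =
  (\prod_(i | P i) F i) * (\prod_(i | P i) G i) * (\prod_(i | P i) H i).
Proof. by rewrite !big_split. Qed.

Definition catn n (m1 m2 : nat -> nat) (j : nat) : nat :=
  if (j < n)%N then m1 j else m2 (j - n)%N.

Lemma catn_l n m1 m2 j : (j < n)%N -> catn n m1 m2 j = m1 j.
Proof. by rewrite /catn => ->. Qed.

Lemma catn_r n m1 m2 j : catn n m1 m2 (n + j) = m2 j.
Proof. by rewrite /catn ltnNge leq_addr /= addKn. Qed.

Lemma rk_catn_l n m1 m2 l s : (s <= n)%N -> rk (catn n m1 m2) l s = rk m1 l s.
Proof. by move=> sn; apply: eq_bigr => i _; rewrite catn_l// (leq_trans _ sn). Qed.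

Lemma rk_catn_r n m1 m2 l s : rk (catn n m1 m2) l (n + s) = (rk m1 l n + rk m2 l s)%N.
Proof.
rewrite /rk big_split_ord /=; congr (_ + _)%N.
  by apply: eq_bigr => i _; rewrite catn_l.
by apply: eq_bigr => i _; rewrite catn_r.
Qed.

End Rank.

Section Ratio.
Context (R : realType).
Local Notation C := (cplx R).
Variables (N : nat) (B : C -> C).
Local Notation "[[ u ]]" := (B u).

Definition diag_coef (kap : C) (s j : nat) : C := if j == s then [[1]] / [[kap]] else 1.

Definition shift_next (kap : C) (s j : nat) : C :=
  if (s < j)%N then -1 else if (j < s)%N then 0 else kap - 1.

(** The contribution of the variables w^(l+1)_j and w^(l)_s, including the factor
    [x + 1] of the denominator H.  All three cases s < j, j < s and j = s have the form
    [y + k] / [y] with y = x + 1, up to a constant. *)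
Definition next_factor (kap : C) (s j : nat) (x : C) : C :=
  diag_coef kap s j * ([[x + 1 + shift_next kap s j]] / [[x + 1]]).

Definition same_factor (x : C) : C := [[x + 1]] / [[x]].

(** The product form of U_I / H.  The label of position s is m s, K l s is the argument
    (P+h)_{mu_s,l+1} - C_{mu_s,l+1}(s), and w l s is the variable v^(l)_a with
    i^(l)_a = s.  The bracket is an arbitrary function B. *)
Definition wprod (n : nat) (m : nat -> nat) (K w : nat -> nat -> C) : C :=
  \prod_(l < N) \prod_(s < n | (m s < l)%N)
   ((\prod_(j < n | (m j < l.+1)%N) next_factor (K l s) s j (w l.+1 j - w l s)) *
    (\prod_(j < n | (m j < l)%N && (s < j)%N) same_factor (w l j - w l s))).

Definition wnumer (n : nat) (m : nat -> nat) (K w : nat -> nat -> C) : C :=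
  \prod_(l < N) \prod_(s < n | (m s < l)%N)
   ([[w l.+1 s - w l s + K l s]] * [[1]] / [[K l s]]
    * (\prod_(j < n | (m j < l.+1)%N && (s < j)%N) [[w l.+1 j - w l s]])
    * (\prod_(j < n | (m j < l.+1)%N && (j < s)%N) [[w l.+1 j - w l s + 1]])
    * (\prod_(j < n | (m j < l)%N && (s < j)%N)
         ([[w l j - w l s + 1]] / [[w l j - w l s]]))).

(** Distributing each factor [x + 1] of H over the pair of positions it belongs to. *)
Lemma wnumer_div n m K w :
  wnumer n m K w /
   (\prod_(l < N) \prod_(s < n | (m s < l)%N) \prod_(j < n | (m j < l.+1)%N)
      [[w l.+1 j - w l s + 1]]) = wprod n m K w.
Proof.
rewrite /wnumer /wprod -prodf_div; apply: eq_bigr => l _.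
rewrite -prodf_div; apply: eq_bigr => s ms.
rewrite mulrAC; congr (_ * _).
have ms1 : (m s < l.+1)%N by rewrite ltnS ltnW.
rewrite (_ : \prod_(j < n | (m j < l.+1)%N) next_factor _ _ _ _ =
   (\prod_(j < n | (m j < l.+1)%N) ((if j == s then
        [[w l.+1 s - w l s + K l s]] * [[1]] / [[K l s]] else 1) *
      (if (s < j)%N then [[w l.+1 j - w l s]] else 1) *
      (if (j < s)%N then [[w l.+1 j - w l s + 1]] else 1))) /
   \prod_(j < n | (m j < l.+1)%N) [[w l.+1 j - w l s + 1]]); last first.
  rewrite -prodf_div; apply: eq_bigr => j mj; rewrite /next_factor /diag_coef /shift_next
      -val_eqE /=.
  case: (ltngtP s j) => [sj|js|/val_inj ->]; rewrite ?mul1r ?mulr1.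
  - by rewrite addrK.
  - by rewrite addr0.
  - rewrite (_ : _ + 1 + (K l j - 1) = w l.+1 j - w l j + K l j); last by ring.
    rewrite ?eqxx; ring.
congr (_ / _); rewrite big_prod3 /=; congr (_ * _ * _).
- rewrite (bigD1 s)//= eqxx big1 ?mulr1// => j /andP[_ js].
  by rewrite (negPf js).
- by rewrite big_mkcondr.
- by rewrite big_mkcondr.
Qed.

Variables (c theta : C).
Hypothesis hc : forall (x k : C) (b1 b2 : bool),
  [[x + c * (b1%:R - b2%:R) + k]] / [[x + c * (b1%:R - b2%:R)]] =
  cexp (theta * k * (b2%:R - b1%:R)) * ([[x + k]] / [[x]]).

Definition moved (L s0 l s : nat) : bool := (l == L) && (s == s0).

(** The coefficient of theta when w^(L)_(s0) is translated: a factor [y + k] / [y]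
    contributes k if w^(L)_(s0) is the subtracted variable of y, and - k if it is the
    added one. *)
Definition exponent (n : nat) (m : nat -> nat) (K : nat -> nat -> C) (L s0 : nat) : C :=
  \sum_(l < N) \sum_(s < n | (m s < l)%N)
   ((\sum_(j < n | (m j < l.+1)%N) shift_next (K l s) s j * ((moved L s0 l s)%:R - (moved L s0
       l.+1 j)%:R)) +
    (\sum_(j < n | (m j < l)%N && (s < j)%N) ((moved L s0 l s)%:R - (moved L s0 l j)%:R))).

Lemma cexp_sum I (s : seq I) (P : pred I) (F : I -> C) :
  cexp (\sum_(i <- s | P i) F i) = \prod_(i <- s | P i) cexp (F i).
Proof. by apply: (big_morph (@cexp R) (@cexpD R) (cexp0 R)). Qed.

Lemma wprod_translate n m K w w' L s0 :
  (forall l s, (s < n)%N -> (m s < l)%N -> w' l s = w l s + c * (moved L s0 l s)%:R) ->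
  wprod n m K w' = cexp (theta * exponent n m K L s0) * wprod n m K w.
Proof.
move=> hw; rewrite /wprod /exponent mulr_sumr cexp_sum -big_split /=.
apply: eq_bigr => l _; rewrite mulr_sumr cexp_sum -big_split /=.
apply: eq_bigr => s ms; rewrite mulrDr cexpD mulrACA; congr (_ * _).
  rewrite mulr_sumr cexp_sum -big_split /=; apply: eq_bigr => j mj.
  rewrite !hw//; set d1 := moved L s0 l.+1 j; set d2 := moved L s0 l s.
  rewrite /next_factor [RHS]mulrCA; congr (_ * _).
  have -> : w l.+1 j + c * d1%:R - (w l s + c * d2%:R) + 1 =
    w l.+1 j - w l s + 1 + c * (d1%:R - d2%:R) by ring.
  by rewrite hc -[theta * _ * _]mulrA.
rewrite mulr_sumr cexp_sum -big_split /=; apply: eq_bigr => j /andP[mj _].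
rewrite !hw//; set d1 := moved L s0 l j; set d2 := moved L s0 l s.
rewrite /same_factor.
have -> : w l j + c * d1%:R - (w l s + c * d2%:R) =
    w l j - w l s + c * (d1%:R - d2%:R) by ring.
by rewrite hc mulr1.
Qed.

End Ratio.

(** * The exponent of quasi-periodicity *)

Section Exponent.
Context (R : realType).
Local Notation C := (cplx R).
Variables (N n : nat) (m : nat -> nat) (Pn : nat -> nat -> C).

(** The argument (P+h)_{mu_s,l+1} - C_{mu_s,l+1}(s), where the label l+1 is the number l
    since labels are counted from 0. *)
Definition dynarg (l s : nat) : C :=
  Pn (m s) l - \sum_(j < n | (s < j)%N) ((m j == m s)%:R - (m j == l)%:R).

Lemma sum_delta (P : pred nat) (G : nat -> C) k s0 :
  \sum_(j < k | P j) G j * (j == s0 :> nat)%:R = if (s0 < k)%N && P s0 then G s0 else 0.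
Proof.
rewrite -(big_ord1_cond_eq +%R G P) big_mkcondr; apply: eq_bigr => j _.
by case: eqP; rewrite ?mulr1 ?mulr0.
Qed.

Lemma dl_nat L s0 l s : (moved L s0 l s)%:R = (l == L)%:R * (s == s0)%:R :> C.
Proof. by rewrite /moved -mulnb natrM. Qed.

Lemma sum_nat_if (P : pred nat) (F : nat -> C) :
  \sum_(j < n | P j) F j = \sum_(j < n) (P j)%:R * F j.
Proof.
by rewrite big_mkcond; apply: eq_bigr => j _; case: (P j); rewrite ?mul1r ?mul0r.
Qed.

Variables (J s0 : nat).
Hypothesis (JN : (J.+1 < N)%N) (s0n : (s0 < n)%N) (ms0 : (m s0 < J.+1)%N).
Hypothesis PnD : forall a b d, (a < N)%N -> (b < N)%N -> (d < N)%N ->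
  Pn a b + Pn b d = Pn a d.

Let L := J.+1.

Let collapse (G : nat -> nat -> C) :
  \sum_(l < N) \sum_(s < n | (m s < l)%N) G l s * (moved L s0 l s)%:R = G L s0.
Proof.
transitivity (\sum_(l < N) (\sum_(s < n | (m s < l)%N) G l s * (s == s0 :> nat)%:R) *
    (l == L :> nat)%:R).
  apply: eq_bigr => l _; rewrite mulr_suml; apply: eq_bigr => s _.
  by rewrite dl_nat mulrA mulrAC.
rewrite (sum_delta xpredT (fun l => \sum_(s < n | (m s < l)%N) G l s * (s == s0 :> nat)%:R)).
by rewrite JN /= (sum_delta (fun s => (m s < L)%N)) s0n ms0.
Qed.

(** The variable w^(L)_(s0) occurs in the factors of level L, as the subtracted
    variable of [next_factor] and on either side in [same_factor], and in those of level
    J = L - 1, as the added variable of [next_factor].  The contributions of the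
    positions with labels other than J cancel.  A position with label J contributes -1:
    through the sums C if it comes after s0, through the counts of factors if it is s0
    or comes before. *)
Lemma exponentE : exponent N n m dynarg L s0 =
  Pn J L - \sum_(j < n) (m j == J)%:R.
Proof.
have -> : exponent N n m dynarg L s0 =
  \sum_(l < N) \sum_(s < n | (m s < l)%N)
    (\sum_(j < n | (m j < l.+1)%N) shift_next (dynarg l s) s j) * (moved L s0 l s)%:R
  - \sum_(l < N) \sum_(s < n | (m s < l)%N)
    (\sum_(j < n | (m j < l.+1)%N) shift_next (dynarg l s) s j * (moved L s0 l.+1 j)%:R)
  + \sum_(l < N) \sum_(s < n | (m s < l)%N)
    (\sum_(j < n | (m j < l)%N && (s < j)%N) 1) * (moved L s0 l s)%:R
  - \sum_(l < N) \sum_(s < n | (m s < l)%N)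
    (\sum_(j < n | (m j < l)%N && (s < j)%N) (moved L s0 l j)%:R).
  rewrite -sumrB -big_split -sumrB; apply: eq_bigr => l _ /=.
  rewrite -sumrB -big_split -sumrB; apply: eq_bigr => s _ /=.
  rewrite !mulr_suml -sumrB -addrA -sumrB; congr (_ + _).
    by apply: eq_bigr => j _; rewrite mulrBr.
  by apply: eq_bigr => j _; rewrite mul1r.
rewrite (collapse (fun l s => \sum_(j < n | (m j < l.+1)%N) shift_next (dynarg l s) s j)).
rewrite (collapse (fun l s => \sum_(j < n | (m j < l)%N && (s < j)%N) 1)).
have -> : \sum_(l < N) \sum_(s < n | (m s < l)%N)
    (\sum_(j < n | (m j < l.+1)%N) shift_next (dynarg l s) s j * (moved L s0 l.+1 j)%:R) =
    \sum_(s < n | (m s < J)%N) shift_next (dynarg J s) s s0.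
  transitivity (\sum_(l < N) (\sum_(s < n | (m s < l)%N) shift_next (dynarg l s) s s0) * (l ==
      J :> nat)%:R).
    apply: eq_bigr => l _; rewrite mulr_suml; apply: eq_bigr => s _.
    rewrite (eq_bigr (fun j : 'I_n => (shift_next (dynarg l s) s j * (l.+1 == L)%:R) * (j == s0
        :> nat)%:R)).
      rewrite (sum_delta (fun j => (m j < l.+1)%N) (fun j => shift_next (dynarg l s) s j *
          (l.+1 == L)%:R)).
      rewrite s0n /= eqSS; case: eqP => [->|_]; last by rewrite !mulr0 if_same.
      by rewrite ms0.
    by move=> j _; rewrite dl_nat mulrA.
  rewrite (sum_delta xpredT (fun l => \sum_(s < n | (m s < l)%N) shift_next (dynarg l s) s s0)).
  by rewrite (ltnW JN).
have -> : \sum_(l < N) \sum_(s < n | (m s < l)%N)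
    (\sum_(j < n | (m j < l)%N && (s < j)%N) (moved L s0 l j)%:R) =
    \sum_(s < n | (m s < L)%N) (s < s0)%:R :> C.
  transitivity (\sum_(l < N) (\sum_(s < n | (m s < l)%N) (s < s0)%:R) * (l == L :> nat)%:R : C).
    apply: eq_bigr => l _; rewrite mulr_suml; apply: eq_bigr => s _.
    rewrite (eq_bigr (fun j : 'I_n => (l == L :> nat)%:R * (j == s0 :> nat)%:R)).
      rewrite (sum_delta (fun j => (m j < l)%N && (s < j)%N) (fun j => (l == L :> nat)%:R)).
      rewrite s0n /=; case: eqP => [->|_]; last by rewrite !mulr0 if_same.
      by rewrite ms0 mulr1; case: ltnP.
    by move=> j _; rewrite dl_nat.
  rewrite (sum_delta xpredT (fun l => \sum_(s < n | (m s < l)%N) (s < s0)%:R)).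
  by rewrite JN.
have Y1 (k : nat) (kap : C) : (m s0 < k)%N -> \sum_(j < n | (m j < k)%N) shift_next kap s0 j =
   kap - 1 - \sum_(j < n) ((m j < k)%N && (s0 < j)%N)%:R.
  move=> hk; rewrite (eq_bigr (fun j : 'I_n => (kap - 1) * (j == s0 :> nat)%:R - (s0 < j)%:R)).
    rewrite big_split /= (sum_delta (fun j => (m j < k)%N) (fun=> kap - 1)) s0n hk /= sumrN.
    congr (_ - _); rewrite (sum_nat_if (fun j => (m j < k)%N) (fun j => (s0 < j)%:R)).
    by apply: eq_bigr => j _; rewrite -natrM mulnb.
  by move=> j _; rewrite /shift_next; case: (ltngtP s0 j) => _; rewrite ?mulr0 ?sub0r ?subr0
      ?mulr1 ?oppr0.
have Y2 (k : nat) : \sum_(s < n | (m s < k)%N) shift_next (dynarg J s) s s0 =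
   (m s0 < k)%:R * (dynarg J s0 - 1) - \sum_(j < n) ((m j < k)%N && (j < s0)%N)%:R.
  rewrite (eq_bigr (fun s : 'I_n => (dynarg J s - 1) * (s == s0 :> nat)%:R - (s < s0)%:R)).
    rewrite big_split /= (sum_delta (fun j => (m j < k)%N) (fun s => dynarg J s - 1)) s0n /= sumrN.
    congr (_ - _); first by case: ifP => _; rewrite ?mul1r ?mul0r.
    rewrite (sum_nat_if (fun j => (m j < k)%N) (fun j => (j < s0)%:R)).
    by apply: eq_bigr => j _; rewrite -natrM mulnb.
  by move=> s _; rewrite /shift_next; case: (ltngtP s s0) => _; rewrite ?mulr0 ?sub0r ?subr0
      ?mulr1 ?oppr0.
rewrite Y1; last exact: ltnW.
rewrite Y2.
rewrite (sum_nat_if (fun s => (m s < L)%N) (fun s => (s < s0)%:R)).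
rewrite (sum_nat_if (fun j => (m j < L)%N && (s0 < j)%N) (fun=> 1)).
have one : 1 = \sum_(j < n) (j == s0 :> nat)%:R :> C.
  transitivity (\sum_(j < n) 1 * (j == s0 :> nat)%:R : C).
    by rewrite (sum_delta xpredT (fun=> 1)) s0n.
  by apply: eq_bigr => j _; rewrite mul1r.
have KE l : dynarg l s0 = Pn (m s0) l -
    \sum_(j < n) (s0 < j)%:R * ((m j == m s0)%:R - (m j == l)%:R).
  by rewrite /dynarg (sum_nat_if (fun j => (s0 < j)%N) (fun j => (m j == m s0)%:R - (m j == l)%:R)).
(* If the label of s0 is below J, then s0 also occurs at level J and the terms
   (P+h)_{m s0, L} and (P+h)_{m s0, J} combine; otherwise its label is J. *)
have [msJ|msJ] := ltnP (m s0) J.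
  rewrite mul1r !KE -(@PnD (m s0) J L) ?(ltnW JN)//; last first.
    by apply: leq_trans msJ _; do 2 apply: ltnW.
  set a := Pn _ J; set b := Pn J L.
  set S1 := \sum_(j < n) _ * _; set S2 := \sum_(j < n) _; set S3 := \sum_(j < n) _ * _.
  set S4 := \sum_(j < n) _; set S5 := \sum_(j < n) _ * 1; set S6 := \sum_(j < n) _ * _.
  have -> : a + b - S1 - 1 - S2 - (a - S3 - 1 - S4) + S5 - S6 =
     b + (- S1 - S2 + S3 + S4 + S5 - S6) by ring.
  congr (_ + _); rewrite /S1 /S2 /S3 /S4 /S5 /S6 -!sumrN -!big_split /=.
  apply: eq_bigr => j _; rewrite /L !ltnS.
  have e1 : (m j <= J.+1)%N = (m j < J)%N || (m j == J) || (m j == J.+1) by lia.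
  have e2 : (m j <= J)%N = (m j < J)%N || (m j == J) by lia.
  have e3 : (m j == J.+1) = (J < m j)%N && (m j == J.+1) by lia.
  rewrite e1 e2 e3; case: (ltngtP s0 j) => [sj|js|sj].
  - by rewrite !andbT !andbF; case: (ltngtP (m j) J) => _ /=; ring.
  - by rewrite !andbT !andbF; case: (ltngtP (m j) J) => _ /=; ring.
  - have -> : m j = m s0 by rewrite sj.
    by rewrite (ltn_eqF msJ) !andbF /=; ring.
have mJ : m s0 = J by apply/eqP; rewrite eqn_leq msJ -ltnS ms0.
rewrite KE !mJ mul0r.
set b := Pn J L.
set S1 := \sum_(j < n) _ * _.
set S2 := \sum_(j < n) _; set S4 := \sum_(j < n) _.
set S5 := \sum_(j < n) _ * 1; set S6 := \sum_(j < n) _ * _.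
have -> : b - S1 - 1 - S2 - (0 - S4) + S5 - S6 =
   b + (- S1 - S2 + S4 + S5 - S6 - \sum_(j < n) (j == s0 :> nat)%:R).
  by rewrite -one; ring.
congr (_ + _); rewrite /S1 /S2 /S4 /S5 /S6 -!sumrN -!big_split /=.
apply: eq_bigr => j _; rewrite /L !ltnS.
have e1 : (m j <= J.+1)%N = (m j < J)%N || (m j == J) || (m j == J.+1) by lia.
have e2 : (m j <= J)%N = (m j < J)%N || (m j == J) by lia.
have e3 : (m j == J.+1) = (J < m j)%N && (m j == J.+1) by lia.
rewrite e1 e2 e3; case: (ltngtP s0 j) => [sj|js|sj].
- by rewrite !andbT !andbF; case: (ltngtP (m j) J) => _ /=; ring.
- by rewrite !andbT !andbF; case: (ltngtP (m j) J) => _ /=; ring.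
- have -> : m j = J by rewrite -sj.
  by rewrite eqxx ltnn !andbF /=; ring.
Qed.

End Exponent.

(** * The product form of a concatenation *)

Section Cat.
Context (R : realType).
Local Notation C := (cplx R).
Variables (N : nat) (B : C -> C).
Local Notation "[[ u ]]" := (B u).
Variables (n1 n2 : nat) (m m1 m2 : nat -> nat) (K K1 K2 w w1 w2 : nat -> nat -> C).
Hypothesis hm1 : forall j, (j < n1)%N -> m j = m1 j.
Hypothesis hm2 : forall j, m (n1 + j)%N = m2 j.
Hypothesis hK1 : forall l s, (l < N)%N -> (s < n1)%N -> (m1 s < l)%N -> K l s = K1 l s.
Hypothesis hK2 : forall l s, (l < N)%N -> (s < n2)%N -> (m2 s < l)%N -> K l (n1 + s)%N = K2 l s.
Hypothesis hw1 : forall l j, (l <= N)%N -> (j < n1)%N -> (m1 j < l)%N -> w l j = w1 l j.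
Hypothesis hw2 : forall l j, (l <= N)%N -> (j < n2)%N -> (m2 j < l)%N ->
  w l (n1 + j)%N = w2 l j.

(** Xi in terms of positions: s runs over the first block and j over the second. *)
Definition cross : C :=
  \prod_(l < N) \prod_(s < n1 | (m1 s < l)%N)
    ((\prod_(j < n2 | (m2 j < l.+1)%N)
        ([[w2 l.+1 j - w1 l s]] / [[w2 l.+1 j - w1 l s + 1]])) *
     (\prod_(j < n2 | (m2 j < l)%N)
        ([[w2 l j - w1 l s + 1]] / [[w2 l j - w1 l s]]))).

Lemma prod_split (P : pred nat) (F : nat -> C) :
  \prod_(s < n1 + n2 | P s) F s =
  (\prod_(s < n1 | P s) F s) * (\prod_(s < n2 | P (n1 + s)%N) F (n1 + s)%N).
Proof. by rewrite big_split_ord. Qed.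

(** Pairs of positions split according to the blocks of their members.  A pair with s
    in the second block and j in the first gives [x + 1] / [x + 1], hence the
    nonvanishing hypothesis. *)
Lemma wprod_cat :
  (forall l j s, (l < N)%N -> (j < n1)%N -> (s < n2)%N -> (m1 j < l.+1)%N -> (m2 s < l)%N ->
    [[w1 l.+1 j - w2 l s + 1]] != 0) ->
  wprod N B (n1 + n2) m K w = wprod N B n1 m1 K1 w1 * wprod N B n2 m2 K2 w2 * cross.
Proof.
move=> nz.
rewrite /wprod /cross mulrAC -!big_split /=; apply: eq_bigr => l _.
rewrite (prod_split (fun s => (m s < l)%N)
  (fun s => (\prod_(j < n1 + n2 | (m j < l.+1)%N) next_factor B (K l s) s j (w l.+1 j - w l s)) *
    (\prod_(j < n1 + n2 | (m j < l)%N && (s < j)%N) same_factor B (w l j - w l s)))).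
congr (_ * _).
  rewrite -big_split /=; apply: eq_big => [s|s ms]; first by rewrite hm1.
  rewrite hm1// in ms.
  rewrite (prod_split (fun j => (m j < l.+1)%N) (fun j => next_factor B (K l s) s j (w l.+1 j -
      w l s))).
  rewrite (prod_split (fun j => (m j < l)%N && (s < j)%N) (fun j => same_factor B (w l j - w l s))).
  rewrite hw1 ?(ltnW (ltn_ord l))// hK1// [LHS]mulrACA; congr ((_ * _) * (_ * _)).
  - apply: eq_big => [j|j mj]; first by rewrite hm1.
    by rewrite hm1// in mj; rewrite hw1.
  - apply: eq_big => [j|j /andP[mj _] ]; first by rewrite hm1.
    by rewrite hm1// in mj; rewrite hw1// ltnW.
  - apply: eq_big => [j|j mj]; first by rewrite hm2.
    rewrite hm2 in mj.
    rewrite hw2// /next_factor /diag_coef /shift_next (ltn_addr _ (ltn_ord s)) gtn_eqF ?ltn_addr//.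
    by rewrite mul1r addrK.
  - apply: eq_big => [j|j /andP[mj _] ]; first by rewrite hm2 ltn_addr// andbT.
    by rewrite hm2 in mj; rewrite hw2// ltnW.
apply: eq_big => [s|s ms]; first by rewrite hm2.
rewrite hm2 in ms.
rewrite (prod_split (fun j => (m j < l.+1)%N)
   (fun j => next_factor B (K l (n1 + s)%N) (n1 + s) j (w l.+1 j - w l (n1 + s)%N))).
rewrite (prod_split (fun j => (m j < l)%N && (n1 + s < j)%N)
   (fun j => same_factor B (w l j - w l (n1 + s)%N))).
rewrite hw2 ?(ltnW (ltn_ord l))// hK2//; congr (_ * _).
  rewrite big1 ?mul1r => [|j mj].
    apply: eq_big => [j|j mj]; first by rewrite hm2.
    by rewrite hm2 in mj; rewrite hw2// /next_factor /diag_coef /shift_next eqn_add2l !ltn_add2l.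
  rewrite hm1// in mj.
  rewrite hw1// /next_factor /diag_coef /shift_next ltnNge (ltnW (ltn_addr _ _))//= ltn_addr//
      ltn_eqF ?ltn_addr//.
  by rewrite addr0 mul1r divff//; apply: nz.
rewrite big1 ?mul1r => [|j /andP[_] ].
  apply: eq_big => [j|j /andP[mj _] ]; first by rewrite hm2 ltn_add2l.
  by rewrite hm2 in mj; rewrite hw2// ltnW.
by rewrite ltnNge (ltnW (ltn_addr _ _)).
Qed.

End Cat.

(** * Coordinates, permutations and splitting of the variables *)

Section Coordinates.
Context (R : realType) (N : nat).
Local Notation C := (cplx R).
Local Notation W := (weight N).
Local Notation Sym := Defs.Sym.

Definition tvar (la : W) (l : 'I_N) (a : 'I_(lev la l)) : 'I_(tdim la) := tagnat.Rank l a.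

Lemma entryE n (w : 'rV[C]_n) (a : 'I_n) : entry w a = w ord0 a.
Proof. by rewrite /entry valK. Qed.

Lemma entry_nat n (w : 'rV[C]_n) a (h : (a < n)%N) : entry w a = w ord0 (Ordinal h).
Proof. by rewrite -entryE. Qed.

Lemma submxrow_tvar (la : W) (t : 'rV[C]_(tdim la)) (l : 'I_N) a :
  submxrow t l ord0 a = t ord0 (tvar a).
Proof. by rewrite mxE. Qed.

Lemma tvar_inj (la : W) (l l' : 'I_N) (a : 'I_(lev la l)) (a' : 'I_(lev la l')) :
  tvar a = tvar a' -> l = l' /\ a = a' :> nat.
Proof.
by move=> /(congr1 val)/eqP; rewrite tagnat.eq_Rank => /andP[/eqP ? /eqP].
Qed.

Lemma tvarP (la : W) (j : 'I_(tdim la)) : exists (l : 'I_N) (a : 'I_(lev la l)), j = tvar a.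
Proof. by exists (tagnat.sig1 j), (tagnat.sig2 j); rewrite /tvar tagnat.sig2K. Qed.

Lemma mxrow_tvar (la : W) (F : forall l : 'I_N, 'rV[C]_(lev la l)) (l : 'I_N) (a : 'I_(lev la l)) :
  (\mxrow_(l < N) F l) ord0 (tvar a) = F l ord0 a.
Proof. by rewrite -submxrow_tvar mxrowK. Qed.

(** A map that acts on each level by an injection of indices, up to constants, acts on
    all variables by an injection. *)
Lemma tvar_selection (la mu : W) (f : 'rV[C]_(tdim la) -> 'rV[C]_(tdim mu))
   (s : forall l : 'I_N, 'I_(lev mu l) -> 'I_(lev la l)) (c : 'I_(tdim mu) -> C) :
  (forall l, injective (s l)) ->
  (forall t (l : 'I_N) (a : 'I_(lev mu l)), f t ord0 (tvar a) = t ord0 (tvar (s l a)) + c (tvar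
      a)) ->
  coord_selection f.
Proof.
move=> sI fE; exists (fun j => tvar (s _ (tagnat.sig2 j))), c; split.
  have key (l l' : 'I_N) (a : 'I_(lev mu l)) (a' : 'I_(lev mu l')) :
     tvar (s l a) = tvar (s l' a') -> tvar a = tvar a'.
    by move=> /tvar_inj [ll']; subst l' => /val_inj /sI ->.
  by move=> j j' /key; rewrite /tvar !tagnat.sig2K.
move=> t j; have jE : j = tvar (tagnat.sig2 j) by rewrite /tvar tagnat.sig2K.
by rewrite {1}jE fE -jE.
Qed.

Lemma vcoord_tvar (la : W) (t : 'rV[C]_(tdim la)) (u : 'rV[C]_(lev la N)) (l : 'I_N)
  (a : 'I_(lev la l)) : vcoord t u l a = t ord0 (tvar a).
Proof. by rewrite /vcoord valK entryE submxrow_tvar. Qed.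

Lemma vcoord_top (la : W) (t : 'rV[C]_(tdim la)) (u : 'rV[C]_(lev la N)) a :
  vcoord t u N a = entry u a.
Proof. by rewrite /vcoord insubF// ltnn. Qed.

Lemma permt_tvar (la : W) (sg : perms la) t (l : 'I_N) (a : 'I_(lev la l)) :
  (permt sg t : 'rV[C]_(tdim la)) ord0 (tvar a) = t ord0 (tvar (sg l a)).
Proof. by rewrite mxrow_tvar !mxE. Qed.

Lemma permt_selection (la : W) (sg : perms la) : coord_selection (@permt R N la sg).
Proof.
apply: (@tvar_selection la la _ (fun l => sg l) (fun=> 0)) => [l|t l a]; first exact: perm_inj.
by rewrite permt_tvar addr0.
Qed.

Lemma eq_tvarP (la : W) (t t' : 'rV[C]_(tdim la)) :
  (forall (l : 'I_N) (a : 'I_(lev la l)), t ord0 (tvar a) = t' ord0 (tvar a)) -> t = t'.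
Proof. by move=> h; apply/rowP => j; have [l [a ->]] := tvarP j. Qed.

Definition perms_mul (la : W) (sg sg' : perms la) : perms la := [ffun l => (sg l * sg' l)%g].

Lemma permtM (la : W) (sg sg' : perms la) (t : 'rV[C]_(tdim la)) :
  permt sg (permt sg' t) = permt (perms_mul sg sg') t.
Proof. by apply: eq_tvarP => l a; rewrite !permt_tvar ffunE permM. Qed.

Definition perms_inv (la : W) (sg : perms la) : perms la := [ffun l => (sg l)^-1%g].

Lemma perms_mulK (la : W) (sg : perms la) : cancel (perms_mul sg) (perms_mul (perms_inv sg)).
Proof. by move=> x; apply/ffunP => l; rewrite !ffunE mulKg. Qed.

Lemma perms_mulKr (la : W) (sg : perms la) : cancel (fun x => perms_mul x sg) (fun x =>
    perms_mul x (perms_inv sg)).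
Proof. by move=> x; apply/ffunP => l; rewrite !ffunE mulgK. Qed.

Lemma Sym_permt (la : W) (sg : perms la) f (t : 'rV[C]_(tdim la)) :
  Sym f (permt sg t) = Sym f t.
Proof.
rewrite /Sym [RHS](reindex_inj (can_inj (perms_mulKr sg))).
by apply: eq_bigr => s _; rewrite permtM.
Qed.

Lemma Sym_comp_permt (la : W) (sg : perms la) f (t : 'rV[C]_(tdim la)) :
  Sym (fun t => f (permt sg t)) t = Sym f t.
Proof.
rewrite /Sym [RHS](reindex_inj (can_inj (perms_mulK sg))).
by apply: eq_bigr => s _; rewrite permtM.
Qed.

Lemma translate_tvar (la : W) (l : 'I_N) (a : 'I_(lev la l)) (c : C) t
    (l' : 'I_N) (a' : 'I_(lev la l')) :
  translate a c t ord0 (tvar a') =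
    t ord0 (tvar a') + c * ((l' == l :> nat) && (a' == a :> nat))%:R.
Proof.
rewrite !mxE eqxx /=; congr (_ + _ * _%:R); congr nat_of_bool.
by rewrite -val_eqE tagnat.eq_Rank -val_eqE.
Qed.

Lemma translate_selection (la : W) (l : 'I_N) (a : 'I_(lev la l)) (c : C) :
  coord_selection (translate a c).
Proof.
exists id, (fun j => c * (j == tvar a)%:R); split; first by [].
by move=> t j; rewrite !mxE eqxx.
Qed.

Lemma permt_translate (la : W) (sg : perms la) (l : 'I_N) (a : 'I_(lev la l)) (c : C)
    (t : 'rV[C]_(tdim la)) :
  permt sg (translate a c t) = translate ((sg l)^-1%g a) c (permt sg t).
Proof.
apply: eq_tvarP => l' a'; rewrite permt_tvar !translate_tvar permt_tvar.
congr (_ + _ * _%:R); case: eqP => //= /val_inj ll'; subst l'.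
by rewrite !val_eqE (can2_eq (permK _) (permKV _)).
Qed.

Variables (nu la la' : W).
Hypothesis nuE : forall i, nu i = (la i + la' i)%N.

Lemma lev_add l : lev nu l = (lev la l + lev la' l)%N.
Proof. by rewrite /lev -big_split; apply: eq_bigr => i _; exact: nuE. Qed.

Lemma ltn_fst l (a : 'I_(lev la l)) : (a < lev nu l)%N.
Proof. by rewrite lev_add ltn_addr. Qed.

Lemma ltn_snd l (a : 'I_(lev la' l)) : (lev la l + a < lev nu l)%N.
Proof. by rewrite lev_add ltn_add2l. Qed.

Definition ord_fst l (a : 'I_(lev la l)) : 'I_(lev nu l) := Ordinal (ltn_fst a).
Definition ord_snd l (a : 'I_(lev la' l)) : 'I_(lev nu l) := Ordinal (ltn_snd a).

Lemma ord_fst_inj l : injective (@ord_fst l).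
Proof. by move=> a a' /(congr1 val) /= /val_inj. Qed.

Lemma ord_snd_inj l : injective (@ord_snd l).
Proof. by move=> a a' /(congr1 val) /= /addnI /val_inj. Qed.

Lemma tfst_tvar (t : 'rV[C]_(tdim nu)) (l : 'I_N) (a : 'I_(lev la l)) :
  tfst la t ord0 (tvar a) = t ord0 (tvar (ord_fst a)).
Proof. by rewrite mxrow_tvar mxE (entry_nat _ (ltn_fst a)) submxrow_tvar. Qed.

Lemma tsnd_tvar (t : 'rV[C]_(tdim nu)) (l : 'I_N) (a : 'I_(lev la' l)) :
  tsnd la la' t ord0 (tvar a) = t ord0 (tvar (ord_snd a)).
Proof. by rewrite mxrow_tvar mxE (entry_nat _ (ltn_snd a)) submxrow_tvar. Qed.

Lemma tfst_selection : coord_selection (@tfst R N nu la).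
Proof.
apply: (@tvar_selection nu la _ (fun l => @ord_fst l) (fun=> 0)) => [l|t l a]; first exact:
    ord_fst_inj.
by rewrite tfst_tvar addr0.
Qed.

Lemma tsnd_selection : coord_selection (@tsnd R N nu la la').
Proof.
apply: (@tvar_selection nu la' _ (fun l => @ord_snd l) (fun=> 0)) => [l|t l a]; first exact:
    ord_snd_inj.
by rewrite tsnd_tvar addr0.
Qed.

Lemma vcoord_tfst (t : 'rV[C]_(tdim nu)) (u : 'rV[C]_(lev nu N)) l a :
  (l <= N)%N -> (a < lev la l)%N ->
  vcoord (tfst la t) (ufst la u) l a = vcoord t u l a.
Proof.
rewrite leq_eqVlt => /predU1P[->|lN] ha.
  by rewrite !vcoord_top (entry_nat _ ha) mxE.
rewrite -[l]/(val (Ordinal lN)) -[a in LHS]/(val (Ordinal ha : 'I_(lev la (Ordinal lN)))).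
rewrite vcoord_tvar tfst_tvar.
by rewrite -[a]/(val (ord_fst (Ordinal ha : 'I_(lev la (Ordinal lN))))) vcoord_tvar.
Qed.

Lemma vcoord_tsnd (t : 'rV[C]_(tdim nu)) (u : 'rV[C]_(lev nu N)) l a :
  (l <= N)%N -> (a < lev la' l)%N ->
  vcoord (tsnd la la' t) (usnd la la' u) l a = vcoord t u l (lev la l + a).
Proof.
rewrite leq_eqVlt => /predU1P[->|lN] ha.
  by rewrite !vcoord_top (entry_nat _ ha) mxE.
rewrite -[l in LHS]/(val (Ordinal lN)) -[a in LHS]/(val (Ordinal ha : 'I_(lev la' (Ordinal lN)))).
rewrite vcoord_tvar tsnd_tvar.
by rewrite -[X in vcoord _ _ _ X]/(val (ord_snd (Ordinal ha : 'I_(lev la' (Ordinal lN)))))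
    (@vcoord_tvar nu t u (Ordinal lN)).
Qed.

End Coordinates.

(** * The weight functions as symmetrized products *)

Section WeightFunction.
Context (R : realType) (N : nat) (lq : cplx R) (r : R).
Local Notation C := (cplx R).
Local Notation W := (weight N).
Local Notation Sym := Defs.Sym.

Definition label (la : W) (mu : labelling la) (j : nat) : nat :=
  if insub j is Some i then mu i : nat else 0%N.

Lemma label_ord (la : W) (mu : labelling la) (i : 'I_(lev la N)) : label mu i = mu i.
Proof. by rewrite /label valK. Qed.

Lemma rank_rk (la : W) (mu : labelling la) l (s : 'I_(lev la N)) :
  rank mu l s = rk (label mu) l s.
Proof.
rewrite /rank -sum1_card /rk (big_ord_widen _ (fun j => (label mu j < l)%N : nat) (ltnW
    (ltn_ord s))).
rewrite [RHS]big_mkcond [LHS]big_mkcond; apply: eq_bigr => j _; rewrite label_ord inE /=.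
by case: (mu j < l)%N; case: (j < s)%N.
Qed.

Lemma parts_count (la : W) (mu : labelling la) (k : 'I_N) : mu \in parts la ->
  la k = (\sum_(i < lev la N) (mu i == k))%N.
Proof.
rewrite inE => /forallP /(_ k) /eqP <-; rewrite -sum1_card big_mkcond.
by apply: eq_bigr => i _; rewrite inE; case: eqP.
Qed.

Lemma lev_rk (la : W) (mu : labelling la) l : mu \in parts la ->
  lev la l = rk (label mu) l (lev la N).
Proof.
move=> hmu; rewrite {1}/lev (eq_bigr _ (fun k _ => parts_count k hmu)) exchange_big /=.
apply: eq_bigr => i _; rewrite label_ord.
have [mil|mil] := boolP (mu i < l)%N.
  rewrite (bigD1 (mu i))//= eqxx big1 ?addn0// => k /andP[_ ki].
  by rewrite eq_sym (negPf ki).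
by rewrite big1// => k kl; case: eqP => // mk; rewrite mk kl in mil.
Qed.

Lemma rk_lev (la : W) (mu : labelling la) l s : mu \in parts la ->
  (s < lev la N)%N -> (label mu s < l)%N -> (rk (label mu) l s < lev la l)%N.
Proof. by move=> hmu sn ms; rewrite (lev_rk _ hmu) rk_ltn. Qed.

(** Indices out of range get the default value 0, which never occurs in a product. *)
Definition dyn_nat (P : dyn R N) (a b : nat) : C :=
  if insub a is Some i then if insub b is Some j then P i j else 0 else 0.

Lemma dyn_nat_ord (P : dyn R N) (i j : 'I_N) : dyn_nat P i j = P i j.
Proof. by rewrite /dyn_nat !valK. Qed.

Definition dynarg_of (la : W) (mu : labelling la) (P : dyn R N) : nat -> nat -> C :=
  dynarg (lev la N) (label mu) (dyn_nat P).

Definition var_at (la : W) (mu : labelling la) (v : nat -> nat -> C) : nat -> nat -> C :=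
  fun l s => v l (rk (label mu) l s).

Lemma U_wnumer (la : W) (mu : labelling la) t u P :
  U_ lq r mu t u P = wnumer N (br lq r) (lev la N) (label mu) (dynarg_of mu P) (var_at mu
      (vcoord t u)).
Proof.
rewrite /U_ /wnumer; set B := br lq r; clearbody B.
apply: eq_bigr => l _; apply: eq_big => [s|s ms]; first by rewrite label_ord.
have KE : P (mu s) l - Cmu R mu s l = dynarg_of mu P l s.
  rewrite /dynarg_of /dynarg label_ord dyn_nat_ord; congr (_ - _).
  by apply: eq_bigr => j _; rewrite /pairing label_ord.
have wE (k : nat) (j : 'I_(lev la N)) : vcoord t u k (rank mu k j) = var_at mu (vcoord t u) k j.
  by rewrite /var_at rank_rk.
rewrite !wE -!addrA KE; congr (_ * _ * _ * _).
- by apply: eq_big => [j|j _]; rewrite ?label_ord ?wE.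
- by apply: eq_big => [j|j _]; rewrite ?label_ord ?wE ?addrA.
- by apply: eq_big => [j|j _]; rewrite ?label_ord ?wE ?addrA.
Qed.

Lemma H_prod (la : W) (mu : labelling la) t u : mu \in parts la ->
  H_ lq r (la := la) t u = \prod_(l < N) \prod_(s < lev la N | (label mu s < l)%N)
    \prod_(j < lev la N | (label mu j < l.+1)%N)
      br lq r (var_at mu (vcoord t u) l.+1 j - var_at mu (vcoord t u) l s + 1).
Proof.
move=> hmu; rewrite /H_; set B := br lq r; clearbody B.
apply: eq_bigr => l _; rewrite (lev_rk l hmu) (lev_rk l.+1 hmu) /var_at.
rewrite -(prod_rk _ _ _ (fun a => \prod_(b < rk (label mu) l.+1 (lev la N))
   B (vcoord t u l.+1 b - vcoord t u l a + 1))).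
apply: eq_bigr => s ms.
by rewrite -(prod_rk _ _ _ (fun b => B (vcoord t u l.+1 b - vcoord t u l (rk (label mu) l s) + 1))).
Qed.

(** The summand of the weight function; dividing before symmetrizing is harmless because
    H is symmetric. *)
Definition Utilde (la : W) (mu : labelling la) : fct R la := fun t u P =>
  U_ lq r mu t u P / H_ lq r (la := la) t u.

Lemma Utilde_wprod (la : W) (mu : labelling la) t u P : mu \in parts la ->
  Utilde mu t u P = wprod N (br lq r) (lev la N) (label mu) (dynarg_of mu P) (var_at mu (vcoord
      t u)).
Proof. by move=> hmu; rewrite /Utilde U_wnumer (H_prod _ _ hmu) wnumer_div. Qed.

Lemma vcoord_permt (la : W) (sg : perms la) t u (l : 'I_N) (a : 'I_(lev la l)) :
  vcoord (permt sg t : 'rV[C]_(tdim la)) u l a = vcoord t u l (sg l a).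
Proof. by rewrite !vcoord_tvar permt_tvar. Qed.

Lemma prod_permt (la : W) (sg : perms la) (t : 'rV[C]_(tdim la)) (u : 'rV[C]_(lev la N)) l
    (F : C -> C) : (l <= N)%N ->
  \prod_(a < lev la l) F (vcoord (permt sg t) u l a) = \prod_(a < lev la l) F (vcoord t u l a).
Proof.
rewrite leq_eqVlt => /predU1P[->|lN].
  by apply: eq_bigr => a _; rewrite !vcoord_top.
rewrite -[l]/(val (Ordinal lN)) [RHS](reindex_inj (@perm_inj _ (sg (Ordinal lN)))).
by apply: eq_bigr => a _; rewrite vcoord_permt.
Qed.

Lemma H_permt (la : W) (sg : perms la) (t : 'rV[C]_(tdim la)) u :
  H_ lq r (la := la) (permt sg t) u = H_ lq r (la := la) t u.
Proof.
rewrite /H_; set B := br lq r; clearbody B; apply: eq_bigr => l _.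
rewrite (prod_permt sg t u (fun x => \prod_(b < lev la l.+1)
   B (vcoord (permt sg t) u l.+1 b - x + 1)) (ltnW (ltn_ord l))).
apply: eq_bigr => a _.
by rewrite (prod_permt sg t u (fun y => B (y - vcoord t u l a + 1)) (ltn_ord l)).
Qed.

Lemma Wt_Sym_Utilde (la : W) (mu : labelling la) t u P :
  Wt lq r mu t u P = Sym (fun t => Utilde mu t u P) t.
Proof.
by rewrite /Wt /Sym mulr_suml; apply: eq_bigr => sg _; rewrite /Utilde H_permt.
Qed.

Lemma lev0 (la : W) : lev la 0 = 0%N.
Proof. by rewrite /lev big1. Qed.

Lemma vcoord_translate (la : W) (l : 'I_N) (a : 'I_(lev la l)) (c : C) t u k b :
  vcoord (translate a c t) u k b =
    vcoord t u k b + c * ((k == l) && (b == a))%:R.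
Proof.
have [kN|kN] := ltnP k N; last first.
  rewrite (gtn_eqF (leq_trans (ltn_ord l) kN)) mulr0 addr0.
  by rewrite /vcoord insubF// ltnNge kN.
rewrite -[k]/(val (Ordinal kN)).
have [bk|bk] := ltnP b (lev la (Ordinal kN)).
  by rewrite -[b]/(val (Ordinal bk)) !vcoord_tvar translate_tvar.
rewrite /vcoord valK /entry insubF ?ltnNge ?bk// add0r.
case: eqP => [kl|_] /=; last by rewrite mulr0.
by rewrite gtn_eqF ?mulr0// (leq_trans (ltn_ord a))// -kl.
Qed.

(** The index a of the translated variable is the rank of a unique position, to which
    the computation of the exponent applies. *)
Lemma Utilde_translate (la : W) (mu : labelling la) (j l : 'I_N) (a : 'I_(lev la l)) c theta t
    u (P : dyn R N) :
  mu \in parts la -> (forall j k l, P j k + P k l = P j l) ->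
  quasi_period lq r c theta -> l = j.+1 :> nat ->
  Utilde mu (translate a c t) u P = cexp (theta * (P j l - (la j)%:R)) * Utilde mu t u P.
Proof.
move=> hmu hP hc lj; rewrite !Utilde_wprod//.
have [s0 [s0n ms0 s0a]] : exists s, [/\ (s < lev la N)%N, (label mu s < l)%N & rk (label mu) l
    s = a].
  by apply: rk_surj; rewrite -(lev_rk _ hmu).
rewrite (wprod_translate N (quasi_period_ratio hc) (dynarg_of mu P) (w := var_at mu (vcoord t
    u)) (L := l) (s0 := s0)).
  congr (cexp (_ * _) * _); rewrite lj in ms0 *.
  rewrite exponentE//.
  - rewrite -lj !dyn_nat_ord; congr (_ - _); rewrite (parts_count j hmu) natr_sum.
    by apply: eq_bigr => i _; rewrite label_ord.
  - by rewrite -lj.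
  - move=> x y z xN yN zN.
    rewrite -[x]/(val (Ordinal xN)) -[y]/(val (Ordinal yN)) -[z]/(val (Ordinal zN)).
    by rewrite !dyn_nat_ord.
move=> k s sn ms; rewrite /var_at vcoord_translate; congr (_ + _ * _%:R).
rewrite /moved; congr nat_of_bool; case: eqP => //= kl.
rewrite -s0a kl; apply/eqP/eqP => [|-> //]; apply: rk_inj => //.
by rewrite -kl.
Qed.

Lemma Wt_translate (la : W) (mu : labelling la) (j l : 'I_N) (a : 'I_(lev la l)) c theta t u (P
    : dyn R N) :
  mu \in parts la -> (forall j k l, P j k + P k l = P j l) ->
  quasi_period lq r c theta -> l = j.+1 :> nat ->
  Wt lq r mu (translate a c t) u P = cexp (theta * (P j l - (la j)%:R)) * Wt lq r mu t u P.
Proof.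
move=> hmu hP hc lj; rewrite !Wt_Sym_Utilde /Sym mulr_sumr; apply: eq_bigr => sg _.
by rewrite permt_translate (@Utilde_translate _ _ j _ _ _ theta).
Qed.

End WeightFunction.

(** * The weight functions lie in the big space *)

Section Membership.
Context (R : realType) (N : nat) (lq : cplx R) (r : R).
Local Notation C := (cplx R).
Local Notation W := (weight N).
Local Notation Sym := Defs.Sym.
Hypothesis hq : 0 < `|cexp lq| < 1.
Hypothesis hr : 0 < r.

Section Coordinate.
Variables (la : W) (sg : perms la) (u : 'rV[C]_(lev la N)).

Definition pcoord (l a : nat) (t : 'rV[C]_(tdim la)) : C := vcoord (permt sg t) u l a.

Lemma differentiable_pcoord l a t : differentiable (pcoord l a) t.
Proof.
have [lN|lN] := ltnP l N; last first.
  rewrite (_ : pcoord l a = fun=> entry u a); first exact: differentiable_cst.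
  by apply/funext => t'; rewrite /pcoord /vcoord insubF// ltnNge lN.
have [al|al] := ltnP a (lev la (Ordinal lN)).
  rewrite (_ : pcoord l a = fun t => t ord0 (tvar (sg (Ordinal lN) (Ordinal al)))).
    exact: differentiable_coord.
  apply/funext => t'; rewrite /pcoord -[l]/(val (Ordinal lN)) -[a]/(val (Ordinal al)).
  by rewrite vcoord_permt vcoord_tvar.
rewrite (_ : pcoord l a = fun=> 0); first exact: differentiable_cst.
apply/funext => t'; rewrite /pcoord -[l]/(val (Ordinal lN)) /vcoord valK.
by rewrite /entry insubF// ltnNge al.
Qed.

Lemma differentiable_pdiff l a l' b c t :
  differentiable (fun t => pcoord l a t - pcoord l' b t + c) t.
Proof.
apply: (@differentiableD _ _ _ (fun t => pcoord l a t - pcoord l' b t) (fun=> c)).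
  by apply: differentiableB; exact: differentiable_pcoord.
exact: differentiable_cst.
Qed.

(** Moving the subtracted variable changes the difference at speed -1. *)
Lemma unit_speed_pdiff l' b l a c : (l < N)%N -> (a < lev la l)%N ->
  ((l' == l) && (b == a)) = false ->
  unit_speed (fun t => pcoord l' b t - pcoord l a t + c).
Proof.
move=> lN al ne; pose a' : 'I_(lev la (Ordinal lN)) := Ordinal al.
exists (tvar (sg (Ordinal lN) a')), true => t s.
rewrite -[t + _]/(translate (sg (Ordinal lN) a') s t) /pcoord permt_translate permK.
by rewrite !vcoord_translate /= ne !eqxx mulr0 mulr1 addr0 expr1; ring.
Qed.

End Coordinate.

Lemma entire_quotient_br_ratio (la : W) (sg : perms la) u (l' b l a : nat) (c c' : C) :
  (l < N)%N -> (a < lev la l)%N -> ((l' == l) && (b == a)) = false ->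
  entire_quotient (fun t => br lq r (pcoord sg u l' b t - pcoord sg u l a t + c) /
                     br lq r (pcoord sg u l' b t - pcoord sg u l a t + c')).
Proof.
move=> lN al ne; apply: entire_quotientM.
  apply: (entire_quotient_br hq hr) => t; exact: differentiable_pdiff.
apply: (entire_quotient_brV hq hr); last exact: unit_speed_pdiff.
by move=> t; exact: differentiable_pdiff.
Qed.

Lemma entire_quotient_Wt (la : W) (mu : labelling la) u P : mu \in parts la ->
  entire_quotient (fun t => Wt lq r mu t u P).
Proof.
move=> hmu.
rewrite (_ : (fun t => _) = fun t => \sum_(sg : perms la)
   wprod N (br lq r) (lev la N) (label mu) (dynarg_of mu P) (var_at mu (vcoord (permt sg t)
       u))); last first.
  by apply/funext => t; rewrite Wt_Sym_Utilde; apply: eq_bigr => sg _; rewrite Utilde_wprod.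
apply: entire_quotient_sum => sg _; rewrite /wprod.
apply: entire_quotient_prod => l _; apply: entire_quotient_prod => s ms.
have rs : (rk (label mu) l s < lev la l)%N by apply: rk_lev.
apply: entire_quotientM; apply: entire_quotient_prod => j.
  move=> mj; rewrite /next_factor; apply: entire_quotientM; first exact: entire_quotient_cst.
  rewrite (_ : (fun t => _) = fun t =>
     br lq r (pcoord sg u l.+1 (rk (label mu) l.+1 j) t - pcoord sg u l (rk (label mu) l s) t
        + (1 + shift_next (dynarg_of mu P l s) s j)) /
     br lq r (pcoord sg u l.+1 (rk (label mu) l.+1 j) t - pcoord sg u l (rk (label mu) l s) t + 1)).
    by apply: entire_quotient_br_ratio => //; rewrite gtn_eqF.
  by apply/funext => t; rewrite addrA.
move=> /andP[mj sj]; rewrite /same_factor.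
rewrite (_ : (fun t => _) = fun t =>
   br lq r (pcoord sg u l (rk (label mu) l j) t - pcoord sg u l (rk (label mu) l s) t + 1) /
   br lq r (pcoord sg u l (rk (label mu) l j) t - pcoord sg u l (rk (label mu) l s) t + 0)).
  by apply: entire_quotient_br_ratio => //; rewrite eqxx /= gtn_eqF// rk_ltn.
by apply/funext => t; rewrite addr0.
Qed.

Definition Wcomb (la : W) (c : labelling la -> C) : fct R la := fun t u P =>
  \sum_(mu : labelling la | mu \in parts la) c mu * Wt lq r mu t u P.

Lemma entire_quotient_Wcomb (la : W) (c : labelling la -> C) u P : entire_quotient (fun t =>
    Wcomb c t u P).
Proof.
apply: entire_quotient_sum => mu hmu; apply: entire_quotientM; first exact: entire_quotient_cst.
exact: entire_quotient_Wt.
Qed.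

Lemma Wt_permt (la : W) (mu : labelling la) (sg : perms la) t u P :
  Wt lq r mu (permt sg t) u P = Wt lq r mu t u P.
Proof. by rewrite !Wt_Sym_Utilde Sym_permt. Qed.

(** Without variables every product is empty. *)
Lemma Wt_weight0 (la : W) (mu : labelling la) t u P : mu \in parts la -> lev la N = 0%N ->
  Wt lq r mu t u P = #|{: perms la}|%:R.
Proof.
move=> hmu n0; rewrite Wt_Sym_Utilde /Sym (eq_bigr (fun=> 1)) ?sumr_const// => sg _.
by rewrite Utilde_wprod// /wprod n0 big1// => l _; rewrite big_ord0.
Qed.

(** All conditions hold identically for linear combinations of weight functions, and are
    transported along an equality that holds on a dense open set.  The translation by r
    is the case theta = 0 of the quasi-periodicity. *)
Lemma inMplus_inM (la : W) (F : fct R la) : inMplus lq r F -> inM lq r F.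
Proof.
move=> [c hF].
have hF' : feq lq r F (Wcomb c) := hF.
have trans (l : 'I_N) (a : 'I_(lev la l)) d theta (j : 'I_N) : quasi_period lq r d theta ->
    l = j.+1 :> nat -> feq lq r (fun t => F (translate a d t))
            (fun t u P => cexp (theta * (P j l - (la j)%:R)) * F t u P).
  move=> hd lj u P hP; have hg := hF' u P hP.
  apply: generically_mono (generically_and hg
     (generically_selection (translate_selection a d) hg)) => t [-> ->].
  rewrite /Wcomb mulr_sumr; apply: eq_bigr => mu hmu.
  have [hP1 _] := hP.
  by rewrite (Wt_translate a t u hmu hP1 hd lj) mulrCA.
split.
- move=> u P hP; exact: entire_quotient_meromorphic (entire_quotient_Wcomb c u P) (hF' u P hP).
- move=> sg u P hP; have hg := hF' u P hP.
  apply: generically_mono (generically_and hg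
     (generically_selection (permt_selection R sg) hg)) => t [-> ->].
  by apply: eq_bigr => mu _; rewrite Wt_permt.
- move=> l a.
  have [l0|l0] := posnP l.
    have h : lev la l = 0%N by rewrite l0 lev0.
    by have := leq_trans (ltn_ord a) (eq_leq h); rewrite ltn0.
  have jN : (l.-1 < N)%N by apply: leq_ltn_trans (leq_pred _) (ltn_ord l).
  move=> u P hP.
  have := @trans l a _ _ (Ordinal jN) (quasi_period_r hq hr) (esym (prednK l0)) u P hP.
  by apply: generically_mono => t ->; rewrite mul0r cexp0 mul1r.
- move=> j l a lj.
  exact: (@trans l a _ _ j (quasi_period_rtau hq hr) lj).
- move=> n0; exists (\sum_(mu : labelling la | mu \in parts la) c mu * #|{: perms la}|%:R).
  move=> u P hP; apply: generically_mono (hF' u P hP) => t ->.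
  by apply: eq_bigr => mu hmu; rewrite Wt_weight0.
Qed.

End Membership.

(** * Concatenation of labellings *)

Section Concatenation.
Context (R : realType) (N : nat) (lq : cplx R) (r : R).
Local Notation C := (cplx R).
Local Notation W := (weight N).
Local Notation Sym := Defs.Sym.

Variables (nu la la' : W).
Hypothesis nuE : forall i, nu i = (la i + la' i)%N.

Local Notation n1 := (lev la N).
Local Notation n2 := (lev la' N).

Definition concat (mu : labelling la) (mu' : labelling la') : labelling nu :=
  [ffun i => match fintype.split (cast_ord (lev_add nuE N) i) with
             | inl a => mu a | inr b => mu' b end].

Lemma concat_fst mu mu' (a : 'I_n1) : concat mu mu' (ord_fst nuE a) = mu a.
Proof.
rewrite ffunE (_ : cast_ord _ _ = unsplit (inl a)); last exact: val_inj.
by rewrite unsplitK.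
Qed.

Lemma concat_snd mu mu' (b : 'I_n2) : concat mu mu' (ord_snd nuE b) = mu' b.
Proof.
rewrite ffunE (_ : cast_ord _ _ = unsplit (inr b)); last exact: val_inj.
by rewrite unsplitK.
Qed.

Lemma label_concat mu mu' : label (concat mu mu') =1 catn n1 (label mu) (label mu').
Proof.
move=> j; rewrite /catn; case: ltnP => hj.
  have := label_ord (concat mu mu') (ord_fst nuE (Ordinal hj)); rewrite concat_fst /= => ->.
  by rewrite -(label_ord mu (Ordinal hj)).
have [hj'|hj'] := ltnP (j - n1) n2.
  have := label_ord (concat mu mu') (ord_snd nuE (Ordinal hj')); rewrite concat_snd /= subnKC//
      => ->.
  by rewrite -(label_ord mu' (Ordinal hj')).
rewrite /label !insubF//; first by rewrite ltnNge hj'.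
by rewrite (lev_add nuE) ltnNge -leq_subRL ?hj'.
Qed.

Lemma label_concat_fst mu mu' j : (j < n1)%N -> label (concat mu mu') j = label mu j.
Proof. by move=> hj; rewrite label_concat catn_l. Qed.

Lemma label_concat_snd mu mu' j : label (concat mu mu') (n1 + j) = label mu' j.
Proof. by rewrite label_concat catn_r. Qed.

Lemma rk_fst mu mu' l s : (s <= n1)%N -> rk (label (concat mu mu')) l s = rk (label mu) l s.
Proof.
move=> hs; rewrite -(@rk_catn_l n1 (label mu) (label mu') l s hs).
by apply: eq_bigr => i _; rewrite label_concat.
Qed.

Lemma rk_snd mu mu' l s : mu \in parts la ->
  rk (label (concat mu mu')) l (n1 + s) = (lev la l + rk (label mu') l s)%N.
Proof.
move=> hmu; rewrite (lev_rk l hmu) -rk_catn_r.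
by apply: eq_bigr => i _; rewrite label_concat.
Qed.

Lemma concat_parts mu mu' : mu \in parts la -> mu' \in parts la' -> concat mu mu' \in parts nu.
Proof.
move=> hmu hmu'; rewrite inE; apply/forallP => k; apply/eqP.
rewrite nuE (parts_count k hmu) (parts_count k hmu') -sum1_card big_mkcond /=.
transitivity (\sum_(i < lev nu N) (label (concat mu mu') i == k))%N.
  by apply: eq_bigr => i _; rewrite inE label_ord -val_eqE; case: eqP.
rewrite (lev_add nuE) big_split_ord /=; congr (_ + _)%N; apply: eq_bigr => i _.
  by rewrite label_concat_fst// label_ord.
by rewrite label_concat_snd label_ord.
Qed.

(** The shift of the dynamical parameters in the star product only sees the numbers of
    labels j and k. *)
Lemma sum_pairing (j k : 'I_N) :
  \sum_l pairing R l j k *+ la' l = (la' j)%:R - (la' k)%:R.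
Proof.
rewrite /pairing (eq_bigr (fun l : 'I_N => (l == j)%:R *+ la' l - (l == k)%:R *+ la' l)).
  have h (i : 'I_N) : \sum_l (l == i)%:R *+ la' l = (la' i)%:R :> C.
    rewrite (bigD1 i)//= eqxx big1 ?addr0// => l li.
    by rewrite (negPf li) mul0rn.
  by rewrite sumrB !h.
by move=> l _; rewrite mulrnBl.
Qed.

(** For a position of the first block, C(s) also sums over the whole second block; this
    is the shift of the dynamical parameters in the star product. *)
Lemma dynarg_concat_fst mu mu' (P : dyn R N) l s : mu' \in parts la' -> (l < N)%N -> (s < n1)%N ->
  dynarg_of (concat mu mu') P l s = dynarg_of mu (dynshift P la') l s.
Proof.
move=> hmu' lN sn; rewrite /dynarg_of /dynarg label_concat_fst// (lev_add nuE) big_mkcond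
    big_split_ord /=.
pose s' := Ordinal sn; pose l' := Ordinal lN.
rewrite -[s]/(val s') -[l]/(val l') label_ord !dyn_nat_ord mxE sum_pairing.
rewrite -big_mkcond /= -big_mkcond /=.
rewrite (eq_bigr (fun j : 'I_n1 => (label mu j == mu s')%:R - (label mu j == l')%:R)); last first.
  by move=> j _; rewrite label_concat_fst.
rewrite opprD addrA addrAC; congr (_ - _ - _).
rewrite (parts_count (mu s') hmu') (parts_count l' hmu') !natr_sum -sumrB.
rewrite (eq_bigl xpredT); last by move=> j; rewrite ltn_addr.
by apply: eq_bigr => j _; rewrite label_concat_snd label_ord !val_eqE.
Qed.

Lemma dynarg_concat_snd mu mu' (P : dyn R N) l s : dynarg_of (concat mu mu') P l (n1 + s) =
    dynarg_of mu' P l s.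
Proof.
rewrite /dynarg_of /dynarg label_concat_snd (lev_add nuE) big_mkcond big_split_ord /=; congr (_
    - _).
rewrite big1 ?add0r; last first.
  by move=> j _; rewrite ltnNge (leq_trans (ltnW (ltn_ord j))) ?leq_addr.
rewrite -big_mkcond /=; apply: eq_big => j; first by rewrite ltn_add2l.
by rewrite label_concat_snd.
Qed.

Lemma Xi_cross mu mu' t1 u1 t2 u2 : mu \in parts la -> mu' \in parts la' ->
  Xi lq r (la := la) (la' := la') t1 u1 t2 u2 =
  cross N (br lq r) n1 n2 (label mu) (label mu') (var_at mu (vcoord t1 u1)) (var_at mu' (vcoord
      t2 u2)).
Proof.
move=> hmu hmu'; rewrite /Xi /cross; set B := br lq r; clearbody B.
apply: eq_bigr => l _; rewrite (lev_rk l hmu) (lev_rk l hmu') (lev_rk l.+1 hmu') /var_at.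
pose F a := (\prod_(b < rk (label mu') l.+1 n2)
   (B (vcoord t2 u2 l.+1 b - vcoord t1 u1 l a) / B (vcoord t2 u2 l.+1 b - vcoord t1 u1 l a + 1))) *
  (\prod_(c < rk (label mu') l n2)
   (B (vcoord t2 u2 l c - vcoord t1 u1 l a + 1) / B (vcoord t2 u2 l c - vcoord t1 u1 l a))).
rewrite -(prod_rk _ _ _ F); apply: eq_bigr => s ms; rewrite /F; set x := vcoord t1 u1 l _.
rewrite -(prod_rk _ _ _ (fun b => B (vcoord t2 u2 l.+1 b - x) / B (vcoord t2 u2 l.+1 b - x + 1))).
by rewrite -(prod_rk _ _ _ (fun b => B (vcoord t2 u2 l b - x + 1) / B (vcoord t2 u2 l b - x))).
Qed.

Definition star_summand (F : fct R la) (G : fct R la') : fct R nu := fun t u P =>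
  F (tfst la t) (ufst la u) (dynshift P la') * G (tsnd la la' t) (usnd la la' u) P *
  Xi lq r (tfst la t) (ufst la u) (tsnd la la' t) (usnd la la' u).

Lemma Utilde_concat mu mu' t u P : mu \in parts la -> mu' \in parts la' ->
  (forall (l : 'I_N) (a : 'I_(lev la l.+1)) (b : 'I_(lev la' l)),
     br lq r (vcoord t u l.+1 a - vcoord t u l (lev la l + b) + 1) != 0) ->
  Utilde lq r (concat mu mu') t u P = star_summand (Utilde lq r mu) (Utilde lq r mu') t u P.
Proof.
move=> hmu hmu' nz; rewrite /star_summand !Utilde_wprod ?concat_parts// (Xi_cross _ _ _ _ hmu hmu').
rewrite [lev nu N](lev_add nuE); apply: wprod_cat.
- by move=> j; exact: label_concat_fst.
- by move=> j; exact: label_concat_snd.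
- by move=> l s lN sn _; exact: dynarg_concat_fst.
- by move=> l s _ _ _; exact: dynarg_concat_snd.
- move=> l j lN jn mj; rewrite /var_at rk_fst; last exact: ltnW.
  by rewrite (vcoord_tfst nuE)//; exact: rk_lev.
- move=> l j lN jn mj; rewrite /var_at (rk_snd _ _ _ hmu).
  by rewrite (vcoord_tsnd nuE)//; exact: rk_lev.
- move=> l j s lN jn sn mj ms; rewrite /var_at.
  have ra : (rk (label mu) l.+1 j < lev la l.+1)%N by exact: rk_lev.
  have rb : (rk (label mu') l s < lev la' l)%N by exact: rk_lev.
  rewrite (vcoord_tfst nuE _ _ lN ra) (vcoord_tsnd nuE _ _ (ltnW lN) rb).
  exact: (nz (Ordinal lN) (Ordinal ra) (Ordinal rb)).
Qed.

End Concatenation.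

(** * The star product of weight functions *)

Section StarProduct.
Context (R : realType) (N : nat) (lq : cplx R) (r : R).
Local Notation C := (cplx R).
Local Notation W := (weight N).
Local Notation Sym := Defs.Sym.
Hypothesis hq : 0 < `|cexp lq| < 1.
Hypothesis hr : 0 < r.

Section Split.
Variables (nu la la' : W).
Hypothesis nuE : forall i, nu i = (la i + la' i)%N.

Section Embedding.
Variables (s1 : perms la) (s2 : perms la').

Definition block_fun l (i : 'I_(lev nu l)) (f : 'I_(lev la l) -> 'I_(lev la l))
    (g : 'I_(lev la' l) -> 'I_(lev la' l)) : 'I_(lev nu l) :=
  match fintype.split (cast_ord (lev_add nuE l) i) with
  | inl a => ord_fst nuE (f a) | inr b => ord_snd nuE (g b) end.

Lemma block_fun_fst l f g (a : 'I_(lev la l)) : block_fun (ord_fst nuE a) f g = ord_fst nuE (f a).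
Proof.
rewrite /block_fun (_ : cast_ord _ _ = unsplit (inl a)); last exact: val_inj.
by rewrite unsplitK.
Qed.

Lemma block_fun_snd l f g (b : 'I_(lev la' l)) : block_fun (ord_snd nuE b) f g = ord_snd nuE (g b).
Proof.
rewrite /block_fun (_ : cast_ord _ _ = unsplit (inr b)); last exact: val_inj.
by rewrite unsplitK.
Qed.

Lemma ord_lev_case l (i : 'I_(lev nu l)) :
  (exists a : 'I_(lev la l), i = ord_fst nuE a) \/ (exists b : 'I_(lev la' l), i = ord_snd nuE b).
Proof.
have [h|h] := ltnP i (lev la l).
  by left; exists (Ordinal h); exact: val_inj.
have h' : (i - lev la l < lev la' l)%N by rewrite ltn_subLR// -(lev_add nuE).
by right; exists (Ordinal h'); apply: val_inj; rewrite /= subnKC.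
Qed.

Lemma block_fun_can l f f' g g' : cancel f f' -> cancel g g' ->
  cancel (fun i : 'I_(lev nu l) => block_fun i f g) (fun i => block_fun i f' g').
Proof.
move=> hf hg i; case: (ord_lev_case i) => [[a ->]|[b ->]].
  by rewrite !block_fun_fst hf.
by rewrite !block_fun_snd hg.
Qed.

Definition block_perms : perms nu :=
  [ffun l : 'I_N => perm (can_inj (block_fun_can (permK (s1 l)) (permK (s2 l))))].

Lemma tfst_block_perms (t : 'rV[C]_(tdim nu)) : tfst la (permt block_perms t) = permt s1 (tfst
    la t).
Proof.
apply: eq_tvarP => l a.
by rewrite permt_tvar !(tfst_tvar nuE) permt_tvar ffunE permE block_fun_fst.
Qed.

Lemma tsnd_block_perms (t : 'rV[C]_(tdim nu)) : tsnd la la' (permt block_perms t) = permt s2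
    (tsnd la la' t).
Proof.
apply: eq_tvarP => l a.
by rewrite permt_tvar !(tsnd_tvar nuE) permt_tvar ffunE permE block_fun_snd.
Qed.

End Embedding.

(** Xi is a product over all variables of each of the two groups. *)
Lemma Xi_permt (s1 : perms la) (s2 : perms la') t1 u1 t2 u2 :
  Xi lq r (la := la) (la' := la') (permt s1 t1) u1 (permt s2 t2) u2 =
  Xi lq r (la := la) (la' := la') t1 u1 t2 u2.
Proof.
rewrite /Xi; set B := br lq r; clearbody B; apply: eq_bigr => l _.
have lN := ltnW (ltn_ord l).
rewrite (prod_permt s1 t1 u1 (fun x =>
   (\prod_(b < lev la' l.+1) (B (vcoord (permt s2 t2) u2 l.+1 b - x) /
       B (vcoord (permt s2 t2) u2 l.+1 b - x + 1))) *
   (\prod_(c < lev la' l) (B (vcoord (permt s2 t2) u2 l c - x + 1) /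
       B (vcoord (permt s2 t2) u2 l c - x)))) lN).
apply: eq_bigr => a _; set x := vcoord t1 u1 l a; congr (_ * _).
  exact: (prod_permt s2 t2 u2 (fun y => B (y - x) / B (y - x + 1)) (ltn_ord l)).
exact: (prod_permt s2 t2 u2 (fun y => B (y - x + 1) / B (y - x)) lN).
Qed.

Lemma card_perms (k : W) : #|{: perms k}| = (\prod_(l < N) (lev k l)`!)%N.
Proof.
rewrite card_dep_ffun foldrE big_image /=; apply: eq_bigr => l _.
exact: card_Sn.
Qed.

(** Every pair of permutations of the two groups extends to a permutation of all
    variables, and the outer symmetrization absorbs it.  The number of such pairs is the
    normalizing constant. *)
Lemma star_Wt_sum mu mu' t u P :
  @star R N lq r nu _ _ (Wt lq r (la := la) mu) (Wt lq r (la := la') mu') t u P =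
  Sym (fun t => star_summand lq r (Utilde lq r mu) (Utilde lq r mu') t u P) t.
Proof.
rewrite /star.
set G := fun t => star_summand lq r (Utilde lq r mu) (Utilde lq r mu') t u P.
rewrite (_ : Sym _ t = \sum_(s1 : perms la) \sum_(s2 : perms la') Sym (fun t => G (permt
    (block_perms s1 s2) t)) t).
  rewrite (eq_bigr (fun=> \sum_(s2 : perms la') Sym G t)); last first.
    move=> s1 _; apply: eq_bigr => s2 _; exact: (Sym_comp_permt (block_perms s1 s2) G t).
  rewrite !sumr_const !card_perms -mulrnA -[X in _ * X]mulr_natl mulrA big_split /=
    [X in _ * X%:R]mulnC.
  rewrite mulVf ?mul1r// pnatr_eq0 muln_eq0 negb_or -!lt0n.
  by apply/andP; split; apply: prodn_gt0 => l; exact: fact_gt0.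
rewrite /Sym [RHS](eq_bigr _ (fun s1 _ => exchange_big _ _ _ _ _ _)) [RHS]exchange_big /=.
apply: eq_bigr => sg _; rewrite !Wt_Sym_Utilde /Sym.
rewrite mulr_suml mulr_suml; apply: eq_bigr => s1 _.
rewrite mulr_sumr mulr_suml; apply: eq_bigr => s2 _.
by rewrite /G /star_summand tfst_block_perms tsnd_block_perms Xi_permt.
Qed.

Definition perms_one (k : W) : perms k := [ffun l => 1%g].

Lemma permt1 (k : W) (t : 'rV[C]_(tdim k)) : permt (perms_one k) t = t.
Proof. by apply: eq_tvarP => l a; rewrite permt_tvar ffunE perm1. Qed.

(** The brackets [x + 1] that have to cancel involve one variable from each group, so
    they are nonzero for generic variables, and for all their permutations. *)
Lemma star_Wt mu mu' : mu \in parts la -> mu' \in parts la' ->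
  feq lq r (@star R N lq r nu _ _ (Wt lq r (la := la) mu) (Wt lq r (la := la') mu'))
    (Wt lq r (concat nuE mu mu')).
Proof.
move=> hmu hmu' u P hP.
pose good (t : 'rV[C]_(tdim nu)) := forall (l : 'I_N) (a : 'I_(lev la l.+1)) (b : 'I_(lev la' l)),
     br lq r (vcoord t u l.+1 a - vcoord t u l (lev la l + b) + 1) != 0.
have hgood : generically good.
  apply: generically_fin => l; apply: generically_fin => a; apply: generically_fin => b.
  have h : generically (fun t => br lq r (pcoord (perms_one nu) u l.+1 a t -
      pcoord (perms_one nu) u l (lev la l + b) t + 1) != 0).
    apply: (generically_br hq hr) => [t|]; first exact: differentiable_pdiff.
    by apply: unit_speed_pdiff; [exact: ltn_ord|exact: ltn_snd|rewrite gtn_eqF].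
  by apply: generically_mono h => t; rewrite /pcoord permt1.
have hall : generically (fun t => forall sg : perms nu, good (permt sg t)).
  apply: generically_fin => sg.
  exact: (generically_selection (permt_selection R sg) hgood).
apply: generically_mono hall => t ht.
rewrite star_Wt_sum Wt_Sym_Utilde; apply: eq_bigr => sg _.
by rewrite Utilde_concat//; exact: ht.
Qed.

Lemma admissible_dynshift (P : dyn R N) : admissible lq r P -> admissible lq r (dynshift P la').
Proof.
move=> [hP1 hP2]; split=> [j k l|j k jk m].
  by rewrite !mxE !sum_pairing -(hP1 j k l); ring.
rewrite mxE sum_pairing; have := hP2 j k jk (m - (la' j)%:Z + (la' k)%:Z).
rewrite (_ : P j k + _ = P j k - ((la' j)%:R - (la' k)%:R) + m%:~R)//.
by rewrite !rmorphD /= rmorphN /= -!pmulrn; ring.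
Qed.

(** Equality on a dense open set pulls back along the two projections, even after any
    permutation of the variables. *)
Lemma feq_star (F F' : fct R la) (G G' : fct R la') : feq lq r F F' -> feq lq r G G' ->
  feq lq r (@star R N lq r nu _ _ F G) (@star R N lq r nu _ _ F' G').
Proof.
move=> hF hG u P hP.
have h1 := generically_selection (tfst_selection R nuE)
  (hF (ufst la u) (dynshift P la') (admissible_dynshift hP)).
have h2 := generically_selection (tsnd_selection R nuE) (hG (usnd la la' u) P hP).
have hall : generically (fun t => forall sg : perms nu,
    F (tfst la (permt sg t)) (ufst la u) (dynshift P la') =
    F' (tfst la (permt sg t)) (ufst la u) (dynshift P la') /\
    G (tsnd la la' (permt sg t)) (usnd la la' u) P =
    G' (tsnd la la' (permt sg t)) (usnd la la' u) P).
  apply: generically_fin => sg.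
  exact: (generically_selection (permt_selection R sg) (generically_and h1 h2)).
apply: generically_mono hall => t ht; rewrite /star; congr (_ * _).
by apply: eq_bigr => sg _; have [-> ->] := ht sg.
Qed.

Lemma star_Wcomb c c' t u P :
  @star R N lq r nu _ _ (Wcomb lq r (la := la) c) (Wcomb lq r (la := la') c') t u P =
  \sum_(mu : labelling la | mu \in parts la) \sum_(mu' : labelling la' | mu' \in parts la')
     (c mu * c' mu') * @star R N lq r nu _ _ (Wt lq r mu) (Wt lq r mu') t u P.
Proof.
rewrite /star /Sym /Wcomb mulr_sumr.
under [RHS]eq_bigr => mu _ do (under eq_bigr => mu' _ do rewrite mulrCA !mulr_sumr).
under [RHS]eq_bigr => mu _ do rewrite exchange_big /=.
rewrite [RHS]exchange_big /=; apply: eq_bigr => sg _.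
rewrite !mulr_suml mulr_sumr; apply: eq_bigr => mu _.
rewrite mulr_sumr mulr_suml mulr_sumr; apply: eq_bigr => mu' _.
by congr (_ * _); ring.
Qed.

End Split.

Lemma feq_refl (la : W) (F : fct R la) : feq lq r F F.
Proof. by move=> u P _; exact: generically_all. Qed.

Lemma inMplus_feq (la : W) (F F' : fct R la) : feq lq r F F' -> inMplus lq r F' -> inMplus lq r F.
Proof.
move=> h [c hc]; exists c => u P hP.
by apply: generically_mono (generically_and (h u P hP) (hc u P hP)) => t [-> ->].
Qed.

Lemma inMplus0 (la : W) : inMplus lq r ((fun _ _ _ => 0) : fct R la).
Proof.
exists (fun=> 0) => u P _; apply: generically_all => t.
by rewrite big1// => mu _; rewrite mul0r.
Qed.

Lemma inMplus_lin (la : W) (a : C) (F G : fct R la) : inMplus lq r F -> inMplus lq r G ->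
  inMplus lq r (fun t u P => a * F t u P + G t u P).
Proof.
move=> [c hc] [c' hc']; exists (fun mu => a * c mu + c' mu) => u P hP.
apply: generically_mono (generically_and (hc u P hP) (hc' u P hP)) => t [-> ->].
rewrite mulr_sumr -big_split /=; apply: eq_bigr => mu _; ring.
Qed.

Lemma inMplus_sum (la : W) (I : Type) (s : seq I) (Q : pred I) (a : I -> C) (F : I -> fct R la) :
  (forall i, Q i -> inMplus lq r (F i)) ->
  inMplus lq r (fun t u P => \sum_(i <- s | Q i) a i * F i t u P).
Proof.
move=> hF; elim: s => [|i s ih].
  apply: inMplus_feq (inMplus0 la) => u P _; apply: generically_all => t.
  by rewrite big_nil.
case Qi : (Q i).
  apply: inMplus_feq (inMplus_lin (a i) (hF i Qi) ih) => u P _; apply: generically_all => t.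
  by rewrite big_cons Qi.
by apply: inMplus_feq ih => u P _; apply: generically_all => t; rewrite big_cons Qi.
Qed.

Lemma inMplus_Wt (la : W) (mu : labelling la) : mu \in parts la -> inMplus lq r (Wt lq r mu).
Proof.
move=> hmu; exists (fun k => (k == mu)%:R) => u P _; apply: generically_all => t.
rewrite (bigD1 mu)//= eqxx mul1r big1 ?addr0// => k /andP[_ kmu].
by rewrite (negPf kmu) mul0r.
Qed.

(** Linear combinations of weight functions multiply term by term into weight functions
    of concatenated labellings. *)
Lemma inMplus_star (nu la la' : W) (F : fct R la) (G : fct R la') :
  (forall i, nu i = (la i + la' i)%N) ->
  inMplus lq r F -> inMplus lq r G -> inMplus lq r (@star R N lq r nu _ _ F G).
Proof.
move=> nuE [c hF] [c' hG].
apply: inMplus_feq (feq_star nuE hF hG) _.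
have h : inMplus lq r (fun t u P =>
  \sum_(mu : labelling la | mu \in parts la) 1 * 
   (\sum_(mu' : labelling la' | mu' \in parts la')
     (c mu * c' mu') * @star R N lq r nu _ _ (Wt lq r mu) (Wt lq r mu') t u P)).
  apply: inMplus_sum => mu hmu; apply: inMplus_sum => mu' hmu'.
  by apply: inMplus_feq (star_Wt nuE hmu hmu') _; apply: inMplus_Wt; exact: concat_parts.
apply: inMplus_feq h => u P _; apply: generically_all => t.
rewrite -/(Wcomb lq r c) -/(Wcomb lq r c') star_Wcomb; apply: eq_bigr => mu _; by rewrite mul1r.
Qed.

Lemma star_feq0 (nu la la' : W) (F : fct R la) (G : fct R la') :
  (forall i, nu i = (la i + la' i)%N) ->
  feq lq r F (fun _ _ _ => 0) \/ feq lq r G (fun _ _ _ => 0) ->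
  feq lq r (@star R N lq r nu _ _ F G) (fun _ _ _ => 0).
Proof.
move=> nuE [h|h] u P hP.
  apply: generically_mono (feq_star nuE h (@feq_refl _ G) u hP) => t ->.
  by rewrite /star /Sym [X in _ * X]big1 ?mulr0// => sg _; rewrite !mul0r.
apply: generically_mono (feq_star nuE (@feq_refl _ F) h u hP) => t ->.
by rewrite /star /Sym [X in _ * X]big1 ?mulr0// => sg _; rewrite mulr0 mul0r.
Qed.

End StarProduct.

Theorem proposition5p10 (R : realType) (N : nat) (hN : (0 < N)%N)
    (lq : cplx R) (hq : 0 < `|cexp lq| < 1) (r : R) (hr : 0 < r) :
  subspace_of (@inMplusgr R N lq r) (@inMgr R N lq r) /\
  (forall x y : gfamily R N,
     inMplusgr lq r x -> inMplusgr lq r y -> inMplusgr lq r (starg lq r x y)).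
Proof.
split.
  split.
  - move=> x [fs hx]; split=> // la; exact: (inMplus_inM hq hr (hx la)).
  - split; first by exists [::] => la _; exact: feq_refl.
    move=> la; exact: inMplus0.
  - move=> c x y [[s hs] hx] [[s' hs'] hy]; split; last first.
      by move=> la; exact: inMplus_lin.
    exists (s ++ s') => la; rewrite mem_cat negb_or => /andP[ls ls'] u P hP.
    apply: generically_mono (generically_and (hs la ls u P hP) (hs' la ls' u P hP)).
    by move=> t [-> ->]; rewrite mulr0 addr0.
move=> x y [[s hs] hx] [[s' hs'] hy].
have kE (nu : weight N) (k : {dffun forall i : 'I_N, 'I_(nu i).+1}) (i : 'I_N) :
    nu i = ([ffun i => k i : nat] i + [ffun i => (nu i - k i)%N] i)%N.
  by rewrite !ffunE subnKC// -ltnS ltn_ord.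
split; last first.
  move=> nu; rewrite /starg.
  have h : inMplus lq r (fun t u P => \sum_(k : {dffun forall i : 'I_N, 'I_(nu i).+1})
      1 * @star R N lq r nu _ _ (x [ffun i => k i : nat]) (y [ffun i => (nu i - k i)%N]) t u P).
    apply: inMplus_sum => k _; exact: (inMplus_star hq hr (kE nu k)).
  apply: inMplus_feq h => u P _; apply: generically_all => t.
  by apply: eq_bigr => k _; rewrite mul1r.
exists [seq [ffun i => (a i + b i)%N] : weight N | a : weight N <- s, b : weight N <- s'] => nu
    hnu u P hP.
have h : generically (fun t => forall k : {dffun forall i : 'I_N, 'I_(nu i).+1},
   @star R N lq r nu _ _ (x [ffun i => k i : nat]) (y [ffun i => (nu i - k i)%N]) t u P = 0).
  apply: generically_fin => k; apply: (star_feq0 (kE nu k)) => //.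
  have [la_s|/hs] := boolP ([ffun i => k i : nat] \in s); last by left.
  have [la_s'|/hs'] := boolP ([ffun i => (nu i - k i)%N] \in s'); last by right.
  case/negP: hnu; apply/allpairsP.
  exists ([ffun i => k i : nat], [ffun i => (nu i - k i)%N]); split=> //=.
  by apply/ffunP => i; rewrite ffunE; exact: kE.
by apply: generically_mono h => t ht; rewrite /starg big1.
Qed.
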